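(* Assume that for every $x\ge 0$ the evaluation map $\delta_x:\widetilde{\mathcal{H}}\to\mathcal{H}$, $\delta_xf=f(x)$, is a bounded linear operator. Let $Y$ be the $\widetilde{\mathcal{H}}$-valued process $$Y(t)=\mathcal{S}_tY(0)+\int_0^t\Gamma(t+\cdot,s)(\sigma(s))\,dL(s),$$ the mild solution of the stochastic partial differential equation $dY(t)=\partial_\xi Y(t)\,dt+\Gamma(t+\cdot,t)(\sigma(t))\,dL(t)$ in $\widetilde{\mathcal{H}}$. If $Y(0)=0$, then $X(t)=\delta_0Y(t)$, where $X(t)=\int_0^t\Gamma(t,s)(\sigma(s))\,dL(s)$ is the Hambit field.
   Context: Let $(\Omega,\mathcal{F},\{\mathcal{F}_t\}_{t\ge0},P)$ be a filtered probability space. $\mathcal{U},\mathcal{V},\mathcal{H}$ are separable Hilbert spaces. $\mathcal{L}(E,F)$ (also $L(E,F)$) denotes bounded linear operators from $E$ to $F$; $\|\cdot\|_{\mathrm{HS}}$ is the Hilbert-Schmidt norm. $\sigma$ is a $\mathcal{U}$-valued predictable process, $\Gamma:\mathbb{R}_+^2\to\mathcal{L}(\mathcal{U},\mathcal{L}(\mathcal{V},\mathcal{H}))$ is measurable, and $L$ is a square-integrable $\mathcal{V}$-valued L\'evy process with zero mean and covariance operator $\mathcal{Q}$ (symmetric, non-negative definite, trace class). It is assumed that $\mathbb{E}[\int_0^t\|\Gamma(t,s)(\sigma(s))\mathcal{Q}^{1/2}\|_{\mathrm{HS}}^2\,ds]<\infty$ for each $t$ considered, and the process $X(t)=\int_0^t\Gamma(t,s)(\sigma(s))\,dL(s)$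 is called a Hambit field. $\widetilde{\mathcal{H}}$ is a separable Hilbert space of strongly measurable $\mathcal{H}$-valued functions on $\mathbb{R}_+$, such that the shift operators $\mathcal{S}_\xi f=f(\xi+\cdot)$, $\xi\ge0$, form a $C_0$-semigroup on $\widetilde{\mathcal{H}}$, whose generator is denoted $\partial_\xi$. It is assumed that for every $f\in\mathcal{V}$ and $t\in\mathbb{R}_+$ the map $\xi\mapsto\Gamma(t+\xi,t)(\sigma(t))f$ is an element of $\widetilde{\mathcal{H}}$, that $\Gamma(t+\cdot,t)(\sigma(t))\in L(\mathcal{V},\widetilde{\mathcal{H}})$, and that $$\mathbb{E}\left[\int_0^t\|\Gamma(s+\cdot,s)(\sigma(s))\mathcal{Q}^{1/2}\|^2_{\mathrm{HS}}\,ds\right]<\infty,\qquad \mathbb{E}\left[\int_0^t\|\Gamma(t+\cdot,s)(\sigma(s))\mathcal{Q}^{1/2}\|^2_{\mathrm{HS}}\,ds\right]<\infty,$$ with Hilbert-Schmidt norms of operators from $\mathcal{V}$ to $\widetilde{\mathcal{H}}$. Under these conditions the SPDE has the unique mild solution $Y(t)=\mathcal{S}_tY(0)+\int_0^t\mathcal{S}_{t-s}\Gamma(s+\cdot,s)(\sigma(s))\,dL(s)=\mathcal{S}_tY(0)+\int_0^t\Gamma(t+\cdot,s)(\sigma(s))\,dL(s)$. *)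

(* Defs.v *)
From Stdlib Require List.
From HB Require Import structures.
From mathcomp Require Export all_boot all_order all_algebra.
From mathcomp Require Export all_classical all_reals all_analysis.

Set Implicit Arguments.
Unset Strict Implicit.
Unset Printing Implicit Defensive.

Import Order.TTheory GRing.Theory Num.Theory.
Import numFieldNormedType.Exports.

Local Open Scope classical_set_scope.
Local Open Scope ring_scope.

HB.mixin Record isHilbert (R : realType) V of CompleteNormedModule R V := {
  inner : V -> V -> R ;
  innerC : forall x y, inner x y = inner y x ;
  innerPl : forall a x y z, inner (a *: x + y) z = a * inner x z + inner y z ;
  inner_norm : forall x, inner x x = `|x| ^+ 2 }.

#[short(type="hilbertType")]
HB.structure Definition Hilbert (R : realType) :=
  { V of isHilbert R V & CompleteNormedModule R V }.

Definition separable (T : topologicalType) : Prop :=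
  exists2 D : set T, countable D & dense D.

(** * Operators *)

Section Operators.
Context {R : realType}.

Definition bounded_linear (V W : normedModType R) (A : V -> W) : Prop :=
  (forall a x y, A (a *: x + y) = a *: A x + A y) /\
  exists M : R, forall x, `|A x| <= M * `|x|.

(* T is an element of L(U, L(V, W)), in curried form. *)
Definition bounded_linear2 (U V W : normedModType R) (T : U -> V -> W) : Prop :=
  [/\ forall u, bounded_linear (T u),
      forall a u u' v, T (a *: u + u') v = a *: T u v + T u' v &
      exists M : R, forall u v, `|T u v| <= M * `|u| * `|v|].

(* O is open in L(U, L(V, W)) for the operator norm: the inequality on
   T' - T says that its operator norm is at most eps. *)
Definition opnorm_open (U V W : normedModType R) (O : set (U -> V -> W)) : Prop :=
  forall T, bounded_linear2 T -> O T ->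
  exists2 eps : R, 0 < eps &
    forall T', bounded_linear2 T' ->
      (forall u v, `|T' u v - T u v| <= eps * `|u| * `|v|) -> O T'.

Definition orthonormal_basis (V : hilbertType R) (B : set V) : Prop :=
  [/\ forall e, B e -> inner e e = 1,
      forall e f, B e -> B f -> e <> f -> inner e f = 0 &
      forall x, (forall e, B e -> inner x e = 0) -> x = 0].

Definition onb (V : hilbertType R) : set V := xget set0 (@orthonormal_basis V).

(* The squared Hilbert-Schmidt norm; +oo if A is not Hilbert-Schmidt. *)
Definition hs_norm2 (V W : hilbertType R) (A : V -> W) : \bar R :=
  \esum_(e in @onb V) (`|A e| ^+ 2)%:E.

Definition symmetric_op (V : hilbertType R) (A : V -> V) : Prop :=
  forall x y, inner (A x) y = inner x (A y).

Definition nonneg_op (V : hilbertType R) (A : V -> V) : Prop :=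
  forall x, 0 <= inner (A x) x.

(* For a non-negative operator, trace class means finite trace. *)
Definition covariance_op (V : hilbertType R) (Q : V -> V) : Prop :=
  [/\ bounded_linear Q, symmetric_op Q, nonneg_op Q &
      (\esum_(e in @onb V) (inner (Q e) e)%:E < +oo)%E].

Definition is_sqrt_op (V : hilbertType R) (Q Qh : V -> V) : Prop :=
  [/\ bounded_linear Qh, symmetric_op Qh, nonneg_op Qh &
      forall x, Qh (Qh x) = Q x].

(* Only the values S t with 0 <= t are constrained. *)
Definition C0_semigroup (E : normedModType R) (S : R -> E -> E) : Prop :=
  [/\ forall t : R, 0 <= t -> bounded_linear (S t),
      forall f, S 0 f = f,
      forall s t : R, 0 <= s -> 0 <= t -> forall f, S (s + t) f = S s (S t f) &
      forall f, S h f @[h --> 0^'+] --> f].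

(* The graph of the infinitesimal generator. *)
Definition generator (E : normedModType R) (S : R -> E -> E) : set (E * E) :=
  [set fg | h^-1 *: (S h fg.1 - fg.1) @[h --> 0^'+] --> fg.2].

End Operators.

(** * Spaces of functions on R_+ *)

Section FunctionSpaces.
Context {R : realType} {H E : hilbertType R}.

Definition strongly_measurable_Rplus (f : R -> H) : Prop :=
  exists u : nat -> R -> H,
    (forall n, finite_set (u n @` `[0, +oo[) /\
       forall y, measurable (`[0, +oo[ `&` u n @^-1` [set y] : set R)) /\
    (forall x : R, 0 <= x -> u n x @[n --> \oo] --> f x).

Variable ev : E -> R -> H.

(* E is a space of H-valued functions on R_+ with the pointwise vector space
   operations: ev f x is the value f(x), relevant for 0 <= x only.  Elements
   are functions, not classes of functions. *)
Definition function_space : Prop :=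
  [/\ forall (a : R) (f g : E) (x : R), 0 <= x -> ev (a *: f + g) x = a *: ev f x + ev g x,
      forall f g : E, (forall x : R, 0 <= x -> ev f x = ev g x) -> f = g &
      forall f, strongly_measurable_Rplus (ev f)].

Definition is_elt (g : R -> H) (f : E) : Prop :=
  forall x : R, 0 <= x -> ev f x = g x.

Definition in_space (g : R -> H) : Prop := exists f, is_elt g f.

(* The function g regarded as an element of E (junk if it is not one). *)
Definition elt (g : R -> H) : E := xget 0 (is_elt g).

Definition shift_op (xi : R) (f : E) : E := elt (fun x => ev f (xi + x)).

End FunctionSpaces.

(* The operator Gamma(t + ., s)(sigma(s)) from V to the function space E. *)
Definition Gamma_curve {R : realType} {Omega : Type} {U V H E : hilbertType R}
    (ev : E -> R -> H) (Gamma : R -> R -> U -> V -> H) (sigma : R -> Omega -> U)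
    (t s : R) (w : Omega) (v : V) : E :=
  elt ev (fun xi => Gamma (t + xi) s (sigma s w) v).

(** * Stochastic integration *)

Section StochasticIntegral.
Context {R : realType} {d : measure_display} {Omega : measurableType d}.
Variables (P : probability Omega R) (F : R -> set (set Omega)).

Definition filtration : Prop :=
  [/\ forall t : R, 0 <= t -> sigma_algebra setT (F t),
      forall t : R, 0 <= t -> F t `<=` measurable &
      forall s t : R, 0 <= s -> s <= t -> F s `<=` F t].

Definition borel_measurable (G : set (set Omega)) (E : topologicalType)
    (Z : Omega -> E) : Prop :=
  forall O : set E, open O -> G (Z @^-1` O).

Definition predictable_rectangle : set (set (R * Omega)) :=
  [set A | (exists2 B, F 0 B & A = [set 0] `*` B) \/
    exists (s t : R) (B : set Omega), [/\ 0 <= s, s <= t, F s B & A = `]s, t] `*` B]].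

Definition predictable_set : set (set (R * Omega)) :=
  <<s `[0, +oo[ `*` setT, predictable_rectangle >>.

Definition predictable (E : topologicalType) (f : R -> Omega -> E) : Prop :=
  forall O : set E, open O ->
    predictable_set [set p | 0 <= p.1 /\ O (f p.1 p.2)].

Variables (V : hilbertType R) (L : R -> Omega -> V).

(* Levy process with respect to the filtration F. *)
Definition levy_process : Prop :=
  [/\ {ae P, forall w, L 0 w = 0},
      forall t : R, 0 <= t -> borel_measurable (F t) (L t),
      forall (s t : R) (A : set Omega) (B : set V), 0 <= s -> s <= t -> F s A -> <<s @open V >> B ->
        P (A `&` [set w | B (L t w - L s w)]) =
          (P A * P [set w | B (L t w - L s w)%R])%E,
      forall (s t : R) (B : set V), 0 <= s -> s <= t -> <<s @open V >> B ->
        P [set w | B (L t w - L s w)] = P (L (t - s) @^-1` B) &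
      forall s eps : R, 0 <= s -> 0 < eps ->
        P [set w | eps < `|L r w - L s w|] @[r --> within `[0, +oo[ (nbhs s)]
          --> 0%E].

Definition square_integrable_process : Prop :=
  forall t : R, 0 <= t -> (\int[P]_w (`|L t w| ^+ 2)%:E < +oo)%E.

Definition zero_mean : Prop :=
  forall (t : R) (x : V), 0 <= t -> (\int[P]_w (inner (L t w) x)%:E = 0)%E.

Definition has_covariance (Q : V -> V) : Prop :=
  forall x y,
    (\int[P]_w (inner (L 1 w) x * inner (L 1 w) y)%:E = (inner (Q x) y)%:E)%E.

Variables (Qh : V -> V) (E : hilbertType R).

(* The elementary process 1_{]lo, hi]} 1_event op; an elementary process is a
   finite sum of such terms. *)
Record elementary_term := ElementaryTerm {
  et_lo : R ; et_hi : R ; et_event : set Omega ; et_op : V -> E }.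

Definition wf_term (c : elementary_term) : Prop :=
  [/\ 0 <= et_lo c, et_lo c <= et_hi c, F (et_lo c) (et_event c) &
      bounded_linear (et_op c)].

Definition elementary_process (cs : seq elementary_term) (s : R) (w : Omega)
    (v : V) : E :=
  \sum_(c <- cs)
     \1_(`]et_lo c, et_hi c] : set R) s *: (\1_(et_event c) w *: et_op c v).

Definition elementary_integral (cs : seq elementary_term) (t : R) (w : Omega)
    : E :=
  \sum_(c <- cs) \1_(et_event c) w *:
    et_op c (L (Num.min (et_hi c) t) w - L (Num.min (et_lo c) t) w).

(* E [ int_0^t || Phi(s) Q^{1/2} ||_HS^2 ds ], with Qh = Q^{1/2} *)
Definition integrand_norm2 (t : R) (Phi : R -> Omega -> V -> E) : \bar R :=
  (\int[P]_w \int[lebesgue_measure]_(s in `[0%R, t])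
     hs_norm2 (fun v => Phi s w (Qh v)))%E.

(* Z is a version of int_0^t Phi(s) dL(s), i.e. the mean-square limit of the
   integrals of elementary processes approximating Phi.  The integral is
   determined up to P-null sets only, hence a relation. *)
Definition stochastic_integral (Phi : R -> Omega -> V -> E) (t : R)
    (Z : Omega -> E) : Prop :=
  [/\ forall (s : R) (w : Omega), 0 <= s -> s <= t -> bounded_linear (Phi s w),
      forall v, predictable (fun s w => if s <= t then Phi s w v else 0),
      (integrand_norm2 t Phi < +oo)%E,
      borel_measurable measurable Z &
      exists cs : nat -> seq elementary_term,
        [/\ forall n, List.Forall wf_term (cs n),
            integrand_norm2 t
              (fun s w v => elementary_process (cs n) s w v - Phi s w v)
              @[n --> \oo] --> 0%E &
            (\int[P]_w (`|elementary_integral (cs n) t w - Z w| ^+ 2)%:E)%E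
              @[n --> \oo] --> 0%E]].

End StochasticIntegral.

(* Y is a mild solution of dY(t) = A Y(t) dt + B(t) dL(t), where A (given by its
   graph) generates a C_0-semigroup. *)
Definition mild_solution {R : realType} {d : measure_display}
    {Omega : measurableType d} (P : probability Omega R)
    (F : R -> set (set Omega)) (V : hilbertType R) (L : R -> Omega -> V)
    (Qh : V -> V) (E : hilbertType R) (A : set (E * E))
    (B : R -> Omega -> V -> E) (Y : R -> Omega -> E) : Prop :=
  exists S : R -> E -> E,
    [/\ C0_semigroup S, generator S = A &
        forall t : R, 0 <= t -> exists2 Z : Omega -> E,
          stochastic_integral P F L Qh (fun s w v => S (t - s) (B s w v)) t Z &
          {ae P, forall w, Y t w = S t (Y 0 w) + Z w}].

(* Main.v *)
Require Import Defs.
From mathcomp Require Import measurable_realfun ring lra.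
Import Order.TTheory GRing.Theory Num.Theory.
Import numFieldNormedType.Exports.
Local Open Scope classical_set_scope.
Local Open Scope ring_scope.
Set Implicit Arguments.
Unset Strict Implicit.
Unset Printing Implicit Defensive.

(* For s <= t, shifting the curve Gamma(s + ., s) by t - s gives
   Gamma(t + ., s), and evaluating the latter at 0 gives Gamma(t, s).  Hence
   the claim reduces to a uniqueness statement: if a bounded operator T
   intertwines two integrands, it intertwines their stochastic integrals.  It is
   tested against one vector f at a time, so that only real random variables
   occur.  The adjoints of the operators of an elementary process carry f to
   vectors of V (Riesz), and for such scalar integrals the isometry
     E[J^2] = E[int_0^t <Q Psi, Psi> ds]
   follows from the independence and stationarity of the increments of L:
   h |-> E[<L h, x>^2] is additive and non-negative, hence linear.  By Parseval,
   <Q Psi, Psi> is a sum of squared coordinates of the operator-valued process,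
   which is at most its squared Hilbert-Schmidt norm, and so tends to zero for
   the difference of two approximating sequences. *)

(** [stochastic_integral] only asserts that some approximating sequence exists, so the sequences
    behind [Z] and [X] are unrelated: the image under [T] of the first has to be compared with the
    second. Their difference is again an elementary process, and the isometry serves to show that
    its integral is small. Intervals and events of its terms may overlap arbitrarily; no common
    refinement is formed, and all pairs of terms are computed instead. The second obstacle is
    measurability. No measurability of the Hilbert-Schmidt norm in (s, w) is established, so
    [integrand_norm2] is only used through monotonicity and is never split along a triangle
    inequality. A coordinate energy, in contrast, is a countable sum of squares of real measurable
    functions: sums are split at that level, and monotonicity leads back to the Hilbert-Schmidt
    norm. Finally, each test vector has its own null set; separability of the target space lets
    countably many test vectors suffice. *)

Section Inner.
Context {R : realType} {V : hilbertType R}.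
Implicit Types x y z : V.

Lemma innerDl x y z : inner (x + y) z = inner x z + inner y z.
Proof. by rewrite -[x]scale1r innerPl mul1r scale1r. Qed.

Lemma inner0l y : inner 0 y = 0.
Proof. by have := innerDl 0 0 y; rewrite addr0 => h; lra. Qed.

Lemma innerZl a x y : inner (a *: x) y = a * inner x y.
Proof. by rewrite -[a *: x]addr0 innerPl inner0l addr0. Qed.

Lemma innerNl x y : inner (- x) y = - inner x y.
Proof. by rewrite -scaleN1r innerZl mulN1r. Qed.

Lemma innerBl x y z : inner (x - y) z = inner x z - inner y z.
Proof. by rewrite innerDl innerNl. Qed.

Lemma innerDr x y z : inner z (x + y) = inner z x + inner z y.
Proof. by rewrite innerC innerDl !(innerC _ z). Qed.

Lemma inner0r y : inner y 0 = 0.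
Proof. by rewrite innerC inner0l. Qed.

Lemma innerZr a x y : inner y (a *: x) = a * inner y x.
Proof. by rewrite innerC innerZl innerC. Qed.

Lemma innerNr x y : inner y (- x) = - inner y x.
Proof. by rewrite innerC innerNl innerC. Qed.

Lemma innerBr x y z : inner z (x - y) = inner z x - inner z y.
Proof. by rewrite innerDr innerNr. Qed.

Lemma inner_suml I (r : seq I) (F : I -> V) y :
  inner (\sum_(i <- r) F i) y = \sum_(i <- r) inner (F i) y.
Proof.
elim: r => [|i r IH]; first by rewrite !big_nil inner0l.
by rewrite !big_cons innerDl IH.
Qed.

Lemma inner_sumr I (r : seq I) (F : I -> V) y :
  inner y (\sum_(i <- r) F i) = \sum_(i <- r) inner y (F i).
Proof. by rewrite innerC inner_suml; apply: eq_bigr => i _; rewrite innerC. Qed.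

Lemma inner_ge0 x : 0 <= inner x x.
Proof. by rewrite inner_norm sqr_ge0. Qed.

Lemma cauchy_schwarz_sqr x y : inner x y ^+ 2 <= inner x x * inner y y.
Proof.
have [y0|y0] := eqVneq (inner y y) 0.
  have /normr0_eq0 -> : `|y| = 0.
    by apply/eqP; rewrite -sqrf_eq0 -inner_norm y0.
  by rewrite inner0r expr0n /= inner0l mulr0.
have yp : 0 < inner y y by rewrite lt_neqAle eq_sym y0 inner_ge0.
(* This is [inner y y] times the part of x orthogonal to y; its squared norm is [inner y y * (inner
   x x * inner y y - inner x y ^+ 2)]. *)
have := inner_ge0 (inner y y *: x - inner x y *: y).
rewrite !(innerBl, innerBr, innerZl, innerZr) (innerC y x) => h.
rewrite -(ler_pM2l yp) -subr_ge0; apply: le_trans h _.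
by rewrite le_eqVlt; apply/orP; left; apply/eqP; ring.
Qed.

Lemma cauchy_schwarz x y : `|inner x y| <= `|x| * `|y|.
Proof.
rewrite -(@ler_pXn2r _ 2) ?nnegrE ?mulr_ge0//.
by rewrite real_normK ?num_real// exprMn -!inner_norm cauchy_schwarz_sqr.
Qed.

Lemma sqr_normD x y : `|x + y| ^+ 2 = `|x| ^+ 2 + 2 * inner x y + `|y| ^+ 2.
Proof. by rewrite -!inner_norm !(innerDl, innerDr) (innerC y x); ring. Qed.

Lemma inner_continuous y : continuous (fun x => inner x y).
Proof.
move=> x; apply/cvgrPdist_le => e e0; near=> z.
rewrite -innerBl (le_trans (cauchy_schwarz _ _))//.
have y1 : 0 < `|y| + 1 by rewrite ltr_wpDl.
have xz : `|x - z| <= e / (`|y| + 1).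
  near: z; apply: cvgr_dist_le; first exact: cvg_id.
  by rewrite divr_gt0.
apply: (@le_trans _ _ (`|x - z| * (`|y| + 1))); first by rewrite ler_wpM2l// lerDl.
by rewrite -ler_pdivlMr.
Unshelve. all: by end_near. Qed.

Lemma inner_cvg (s : nat -> V) x y :
  s n @[n --> \oo] --> x -> inner (s n) y @[n --> \oo] --> inner x y.
Proof. by move=> sx; apply: (cvg_comp s (fun z => inner z y) sx); exact: inner_continuous. Qed.

(** If x were nonzero, density would give d in D with |x - d| < |x|, while orthogonality gives |x -
    d|^2 = |x|^2 + |d|^2. *)
Lemma dense_inner_eq0 (D : set V) x :
  dense D -> (forall d, D d -> inner x d = 0) -> x = 0.
Proof.
move=> dD xD; apply/eqP; rewrite -normr_eq0 eq_le normr_ge0 andbT leNgt.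
apply/negP => x0.
have [||d [xd Dd]] := dD (ball x `|x|); last 1 first.
- have : `|x - d| ^+ 2 < `|x| ^+ 2.
    by rewrite ltrXn2r// -?ball_normE//; move: xd; rewrite -ball_normE.
  by rewrite sqr_normD normrN innerNr xD// ltNge oppr0 mulr0 addr0 lerDl sqr_ge0.
- by exists x; exact: ballxx.
- exact: ball_open.
Qed.

End Inner.

Section BoundedLinear.
Context {R : realType} {V W : normedModType R}.

Lemma bounded_linear0 (A : V -> W) : bounded_linear A -> A 0 = 0.
Proof. by case=> + _ => /(_ (-1) 0 0); rewrite scaler0 addr0 scaleN1r addNr. Qed.

Lemma bounded_linearB (A : V -> W) x y : bounded_linear A -> A (x - y) = A x - A y.
Proof. by case=> lA _; rewrite addrC -scaleN1r lA scaleN1r addrC. Qed.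

Lemma bounded_linear_bound (A : V -> W) : bounded_linear A ->
  exists2 M : R, 0 < M & forall x, `|A x| <= M * `|x|.
Proof.
case=> _ [M AM]; exists (`|M| + 1); first by rewrite ltr_wpDl.
move=> x; apply: le_trans (AM x) _; rewrite ler_wpM2r//.
by rewrite (le_trans (ler_norm _))// lerDl.
Qed.

Lemma bounded_linear_continuous (A : V -> W) : bounded_linear A -> continuous A.
Proof.
move=> bA; have [M M0 AM] := bounded_linear_bound bA.
move=> x; apply/cvgrPdist_le => e e0; near=> z.
rewrite -bounded_linearB// (le_trans (AM _))// -ler_pdivlMl//.
near: z; apply: cvgr_dist_le; first exact: cvg_id.
by rewrite mulr_gt0// invr_gt0.
Unshelve. all: by end_near. Qed.

Lemma bounded_linear_cvg (A : V -> W) (s : nat -> V) x : bounded_linear A ->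
  s n @[n --> \oo] --> x -> A (s n) @[n --> \oo] --> A x.
Proof.
by move=> bA sx; apply: (cvg_comp s A sx); exact: bounded_linear_continuous.
Qed.

End BoundedLinear.

Lemma bounded_linear_comp {R : realType} {V W Z : normedModType R}
    (A : V -> W) (B : W -> Z) :
  bounded_linear A -> bounded_linear B -> bounded_linear (B \o A).
Proof.
move=> bA bB; have [M M0 AM] := bounded_linear_bound bA.
have [N N0 BN] := bounded_linear_bound bB.
case: bA bB => lA _ [lB _]; split=> [a x y|]; first by rewrite /= lA lB.
by exists (N * M) => x; rewrite /= (le_trans (BN _))// -mulrA ler_wpM2l// ltW.
Qed.

(** * Orthonormal expansions and Riesz representation in a separable Hilbert space *)

Section OrthonormalBasis.
Context {R : realType} {V : hilbertType R}.

(** Zorn gives a maximal orthonormal set; a nonzero vector orthogonal to it could be normalised and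
    added. *)
Lemma orthonormal_basis_exists : exists B : set V, orthonormal_basis B.
Proof.
pose ortho (B : set V) := (forall e, B e -> inner e e = 1) /\
  (forall e f, B e -> B f -> e <> f -> inner e f = 0).
have [|B [[B1 B0] Bmax]] := @Zorn_bigcup V ortho.
  move=> F FP Ftot; split=> [e [X FX Xe]|e f [X FX Xe] [Y FY Yf]].
    by have [+ _] := FP _ FX; exact.
  by case: (Ftot _ _ FX FY) => XY; [have [_ +] := FP _ FY|have [_ +] := FP _ FX];
    apply=> //; exact: XY.
exists B; split=> // x xB; apply: contrapT => /eqP x0.
have nx0 : `|x| != 0 by rewrite normr_eq0.
pose e := `|x|^-1 *: x.
have eB f : B f -> inner e f = 0 by move=> Bf; rewrite innerZl xB// mulr0.
have ee : inner e e = 1.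
  by rewrite innerZl innerZr inner_norm expr2 mulKf// mulVf.
apply: (Bmax (B `|` [set e])).
  split; first by move=> y; left.
  move=> /(_ e) h; have /eB : B e by apply: h; right.
  by rewrite ee => /eqP; rewrite oner_eq0.
split=> [f [/B1//|->//]|f g [Bf|->] [Bg|->] fg] //.
- exact: B0.
- by rewrite innerC eB.
- exact: eB.
Qed.

Lemma onbP : orthonormal_basis (@onb R V).
Proof. by have [B hB] := orthonormal_basis_exists; exact: (@xgetI _ set0 _ B). Qed.

(** Distinct basis vectors are at distance sqrt 2. Points of the dense set chosen within 1/2 of them
    are therefore distinct, since a shared one would put two basis vectors at distance below 1. *)
Lemma onb_countable : separable V -> countable (@onb R V).
Proof.
move=> [D cD dD]; have [B1 B0 _] := onbP.
have near_pt (e : V) : exists d, D d /\ `|e - d| < 1/2.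
  have [||d [ed Dd]] := dD (ball e (1/2)).
  - by exists e; apply: ballxx; rewrite divr_gt0.
  - exact: ball_open.
  - by exists d; split => //; move: ed; rewrite -ball_normE.
have [g gP] := choice near_pt.
have : (@onb R V #<= D)%card.
  apply/pcard_leP; apply/injfunPex; exists g; first by move=> e _; case: (gP e).
  move=> e f /set_mem Be /set_mem Bf gef; apply: contrapT => ef.
  have : `|e - f| < 1.
    have -> : e - f = (e - g e) + (g f - f) by rewrite gef addrA subrK.
    apply: le_lt_trans (ler_normD _ _) _; rewrite (distrC (g f)).
    by have [_ ?] := gP e; have [_ ?] := gP f; lra.
  rewrite -(@ltr_pXn2r _ 2) ?nnegrE// expr1n -inner_norm innerBl !innerBr.
  by rewrite !B1// (innerC f) (B0 e f)//; lra.
by move/sub_countable; exact.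
Qed.

(** Zero entries are allowed so that one sequence indexed by [nat] serves a basis of any countable
    size, finite ones included. *)
Definition complete_orthoseq (e : nat -> V) : Prop :=
  [/\ forall i j, i != j -> inner (e i) (e j) = 0,
      forall i, e i = 0 \/ inner (e i) (e i) = 1 &
      forall x, (forall i, inner x (e i) = 0) -> x = 0].

(** An injection of the basis into [nat] is inverted. Indices outside its range get the default
    vector 0, which is why [a] has to vanish at 0. *)
Lemma onb_seq : separable V -> exists2 e : nat -> V, complete_orthoseq e &
  forall a : V -> \bar R, a 0 = 0%E -> (forall x, 0 <= a x)%E ->
    \esum_(x in @onb R V) a x = (\sum_(k <oo) a (e k))%E.
Proof.
move=> sV; have [B1 B0 BT] := onbP.
have /countable_injP [f finj] := onb_countable sV.
pose e k := xget 0 [set v | @onb R V v /\ f v = k].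
have eP k : e k = 0 \/ (@onb R V (e k) /\ f (e k) = k).
  by rewrite /e; case: xgetP => [v _ ?|_]; [right|left].
have ef v : @onb R V v -> e (f v) = v.
  move=> Bv; rewrite /e; case: xgetP => [u _ [Bu fu]|/(_ v)[]//].
  by apply: finj => //; exact/mem_set.
exists e.
  split=> [i j ij|i|x xe].
  - case: (eP i) => [->|[Bi fi]]; first by rewrite inner0l.
    case: (eP j) => [->|[Bj fj]]; first by rewrite inner0r.
    by apply: B0 => // eij; move: ij; rewrite -fi -fj eij eqxx.
  - by case: (eP i) => [->|[/B1]]; [left|right].
  - by apply: BT => v Bv; rewrite -(ef v Bv).
move=> a a0 a_ge0.
pose P : pred nat := fun k => e k != 0.
have -> : @onb R V = e @` [set` P].
  apply/seteqP; split=> [v Bv|_ [k Pk <-]].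
    exists (f v); rewrite ?ef//=; rewrite /P unfold_in ef//; apply/eqP => v0.
    by move: (B1 _ Bv); rewrite v0 inner0l => /eqP; rewrite eq_sym oner_eq0.
  by case: (eP k) => [e0|[]//]; move: Pk; rewrite /P /= unfold_in e0 eqxx.
rewrite esum_pred_image//.
  rewrite eseries_mkcond; apply: eq_eseriesr => k _.
  by rewrite /P; case: ifPn => //; rewrite negbK => /eqP ->.
move=> i j /set_mem + /set_mem + eij; rewrite /= /P !unfold_in => i0 j0.
case: (eP i) => [ei|[_ fi]]; first by rewrite ei eqxx in i0.
case: (eP j) => [ej|[_ fj]]; first by rewrite ej eqxx in j0.
by rewrite -fi -fj eij.
Qed.

Variable e : nat -> V.
Hypothesis eP : complete_orthoseq e.

Lemma inner_orthoseq_sum (a : nat -> R) n k : e k != 0 ->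
  inner (\sum_(0 <= i < n) a i *: e i) (e k) = if (k < n)%N then a k else 0.
Proof.
case: eP => e0 e1 _ ek0; have ekk : inner (e k) (e k) = 1.
  by case: (e1 k) => // ek; rewrite ek eqxx in ek0.
rewrite big_mkord inner_suml; case: ltnP => kn.
  rewrite (bigD1 (Ordinal kn))//= innerZl ekk mulr1 big1 ?addr0// => i ik.
  by rewrite innerZl e0 ?mulr0.
rewrite big1// => i _; rewrite innerZl e0 ?mulr0//.
by rewrite neq_ltn (leq_trans (ltn_ord i) kn).
Qed.

(** Pythagoras; only an inequality, because an index with [e i = 0] contributes nothing on the
    left. *)
Lemma sqr_norm_orthoseq_sum (a : nat -> R) (m n : nat) :
  `|\sum_(m <= i < n) a i *: e i| ^+ 2 <= \sum_(m <= i < n) a i ^+ 2.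
Proof.
case: eP => e0 e1 _; elim: n => [|n IH].
  by rewrite !big_geq// normr0 expr0n.
have [mn|nm] := leqP m n; last by rewrite !big_geq// normr0 expr0n.
have e_perp : inner (\sum_(m <= i < n) a i *: e i) (e n) = 0.
  rewrite inner_suml big_nat big1// => i /andP[_ ni].
  by rewrite innerZl e0 ?mulr0// neq_ltn ni.
rewrite !big_nat_recr//= sqr_normD innerZr e_perp !mulr0 addr0 lerD//.
rewrite -(inner_norm (_ *: e n)) innerZl innerZr mulrA -expr2.
by case: (e1 n) => ->; rewrite ?inner0l ?mulr0 ?mulr1// sqr_ge0.
Qed.

Lemma riesz_fischer (a : nat -> R) (C : R) :
  (forall n, \sum_(0 <= i < n) a i ^+ 2 <= C) ->
  exists y : V, \sum_(0 <= i < n) a i *: e i @[n --> \oo] --> y.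
Proof.
move=> aC; suff : cvgn (series (fun i => a i *: e i)).
  by move=> h; exists (limn (series (fun i => a i *: e i))).
apply/cauchy_cvgP/cauchy_seriesP => eps eps0.
have : cvgn (series (fun i => a i ^+ 2)).
  apply: nondecreasing_is_cvgn; last by exists C => _ [n _ <-]; exact: aC.
  apply/nondecreasing_seqP => n.
  by rewrite /series /= big_nat_recr//= lerDl sqr_ge0.
move=> /cauchy_cvgP/cauchy_seriesP/(_ (eps ^+ 2)).
rewrite exprn_gt0// => /(_ isT); apply: filterS => n.
rewrite ger0_norm ?sumr_ge0// => [h|i _]; last exact: sqr_ge0.
rewrite -(@ltr_pXn2r _ 2) ?nnegrE ?(ltW eps0)//.
exact: le_lt_trans (sqr_norm_orthoseq_sum _ _ _) h.
Qed.

Lemma inner_sum_orthoseq_cvg (a : nat -> R) (y : V) k : e k != 0 ->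
  \sum_(0 <= i < n) a i *: e i @[n --> \oo] --> y -> inner y (e k) = a k.
Proof.
move=> ek0 ay.
have h1 : inner (\sum_(0 <= i < n) a i *: e i) (e k) @[n --> \oo] --> inner y (e k).
  exact: inner_cvg.
apply: (cvg_unique _ h1 _) => //.
apply: cvg_near_cst; exists k.+1 => // n /= kn.
by rewrite inner_orthoseq_sum// kn.
Qed.

(** With S the partial expansion of x and s the sum of squares, |x - S|^2 >= 0 reads 2 s <= |x|^2 +
    |S|^2, and |S|^2 <= s. *)
Lemma bessel (x : V) n : \sum_(0 <= i < n) inner x (e i) ^+ 2 <= `|x| ^+ 2.
Proof.
have := sqr_norm_orthoseq_sum (fun i => inner x (e i)) 0 n.
have := sqr_ge0 `|x - \sum_(0 <= i < n) inner x (e i) *: e i|.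
rewrite sqr_normD normrN innerNr inner_sumr.
under eq_bigr do rewrite innerZr -expr2.
lra.
Qed.

Lemma orthoseq_expansion (x : V) :
  \sum_(0 <= i < n) inner x (e i) *: e i @[n --> \oo] --> x.
Proof.
have [y hy] := riesz_fischer (bessel x).
suff xy : x - y = 0 by rewrite -[x in X in _ --> X](subrK y) xy add0r.
case: eP => _ _; apply => k.
have [->|ek0] := eqVneq (e k) 0; first by rewrite inner0r.
by rewrite innerBl (inner_sum_orthoseq_cvg ek0 hy) subrr.
Qed.

Lemma parseval (x : V) :
  ((`|x| ^+ 2)%:E = \sum_(k <oo) (inner x (e k) ^+ 2)%:E)%E.
Proof.
apply/esym/cvg_lim => //; apply/fine_cvgP.
rewrite -inner_norm.
have h := inner_cvg (y := x) (@orthoseq_expansion x).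
have E n : inner (\sum_(0 <= i < n) inner x (e i) *: e i) x =
    \sum_(0 <= i < n) inner x (e i) ^+ 2.
  by rewrite inner_suml; apply: eq_bigr => i _; rewrite innerZl innerC expr2.
split; first by apply: nearW => n; rewrite sumEFin.
apply: cvg_trans h; apply: near_eq_cvg; apply: nearW => n /=.
by rewrite sumEFin E.
Qed.

(** The representing vector has coordinates phi(e i). If S is its partial sum and s the sum of the
    phi(e i)^2, then phi(S) = s, so s <= M |S|; with |S|^2 <= s this gives s <= M^2, and
    [riesz_fischer] applies. *)
Lemma riesz_representation (phi : V -> R) :
  bounded_linear (phi : V -> R^o) -> exists y, forall x, phi x = inner x y.
Proof.
move=> bphi; have [M M0 phiM] := bounded_linear_bound bphi.
have [lphi _] := bphi; have phi0 : phi 0 = 0 := bounded_linear0 bphi.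
have phi_sum (a : nat -> R) n : phi (\sum_(0 <= i < n) a i *: e i) =
    \sum_(0 <= i < n) a i * phi (e i).
  elim: n => [|n IH]; first by rewrite !big_geq.
  by rewrite !big_nat_recr//= addrC lphi IH addrC.
have [y hy] : exists y : V, \sum_(0 <= i < n) phi (e i) *: e i @[n --> \oo] --> y.
  apply: (@riesz_fischer _ (M ^+ 2)) => n.
  set s := \sum_(0 <= i < n) _.
  have s0 : 0 <= s by apply: sumr_ge0 => i _; exact: sqr_ge0.
  have h1 : s <= M * `|\sum_(0 <= i < n) phi (e i) *: e i|.
    apply: le_trans (phiM _); apply: le_trans (ler_norm _).
    by rewrite phi_sum.
  have h2 : `|\sum_(0 <= i < n) phi (e i) *: e i| ^+ 2 <= s.
    exact: sqr_norm_orthoseq_sum.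
  have [->|sn0] := eqVneq s 0; first exact: sqr_ge0.
  have sp : 0 < s by rewrite lt_neqAle eq_sym sn0.
  rewrite -(ler_pM2r sp) -expr2.
  apply: (@le_trans _ _ ((M * `|\sum_(0 <= i < n) phi (e i) *: e i|) ^+ 2)).
    by rewrite ler_pXn2r// nnegrE mulr_ge0// ltW.
  by rewrite exprMn ler_wpM2l// sqr_ge0.
exists y => x.
have h1 := inner_cvg (y := y) (@orthoseq_expansion x).
have h2 := bounded_linear_cvg bphi (@orthoseq_expansion x).
apply: (cvg_unique _ h2 _) => //; apply: cvg_trans h1; apply: near_eq_cvg.
apply: nearW => n /=; rewrite phi_sum inner_suml; apply: eq_bigr => i _.
rewrite innerZl; congr *%R; rewrite innerC.
have [->|ei0] := eqVneq (e i) 0; first by rewrite inner0r phi0.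
by rewrite (inner_sum_orthoseq_cvg ei0 hy).
Qed.

End OrthonormalBasis.

Section LowerIntegral.
Context d (T : measurableType d) (R : realType).
Variable mu : {measure set T -> \bar R}.

Lemma measurable_fun_opens (D : set T) (g : T -> R) :
  (forall O : set R, open O -> measurable (D `&` g @^-1` O)) -> measurable_fun D g.
Proof.
move=> gO; apply: (measurability _ (RGenOpens.measurableE R)).
by move=> _ [_ [a [b ->] <-]]; apply: gO; exact: interval_open.
Qed.

(* Neither function need be measurable: the integral of a non-negative function
   is a supremum over the simple functions below it. *)
Lemma le_lower_integral (D : set T) (f g : T -> \bar R) :
  (forall x, D x -> 0 <= f x)%E -> (forall x, D x -> f x <= g x)%E ->
  (\int[mu]_(x in D) f x <= \int[mu]_(x in D) g x)%E.
Proof.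
move=> f0 fg; rewrite !(integral_mkcond D).
have h0 x : (0 <= (f \_ D) x)%E by exact: erestrict_ge0.
have fg' x : ((f \_ D) x <= (g \_ D) x)%E by exact: lee_restrict.
rewrite !ge0_integralTE//; last by move=> x; exact: le_trans (h0 x) (fg' x).
apply: le_ereal_sup => _ [h hf <-]; exists h => // x.
exact: le_trans (hf x) (fg' x).
Qed.

End LowerIntegral.

(** * Square-integrable random variables, laws and independence *)

Section SquareIntegrable.
Context d (T : measurableType d) (R : realType).
Variable P : probability T R.
Implicit Types f g h : T -> R.

Definition sq_integrable f := measurable_fun setT f /\
  (\int[P]_x (f x ^+ 2)%:E < +oo)%E.

Lemma sq_integrable_le f g (C : R) : 0 <= C -> measurable_fun setT f ->
  sq_integrable g -> (forall x, f x ^+ 2 <= C * g x ^+ 2) -> sq_integrable f.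
Proof.
move=> C0 mf [mg g2] fg; split => //.
apply: (@le_lt_trans _ _ (\int[P]_x (C%:E * (g x ^+ 2)%:E))%E).
  by apply: le_lower_integral => x _; rewrite -?EFinM lee_fin ?sqr_ge0.
rewrite ge0_integralZl//; last 2 first.
- apply/measurable_EFinP; exact: measurable_funX.
- by move=> x _; rewrite lee_fin sqr_ge0.
- by rewrite lte_mul_pinfty.
Qed.

Lemma sq_integrableD f g : sq_integrable f -> sq_integrable g ->
  sq_integrable (fun x => f x + g x).
Proof.
move=> [mf f2] [mg g2]; split; first exact: measurable_funD.
apply: (@le_lt_trans _ _ (\int[P]_x (2%:E * (f x ^+ 2)%:E + 2%:E * (g x ^+ 2)%:E))%E).
  apply: le_lower_integral => x _; rewrite -?EFinM -?EFinD lee_fin ?sqr_ge0//.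
  have := sqr_ge0 (f x - g x); nra.
have mf2 : measurable_fun setT (fun x => (f x ^+ 2)%:E) by apply/measurable_EFinP; exact: measurable_funX.
have mg2 : measurable_fun setT (fun x => (g x ^+ 2)%:E) by apply/measurable_EFinP; exact: measurable_funX.
rewrite ge0_integralD//; last 4 first.
- by move=> x _; rewrite -EFinM lee_fin mulr_ge0 ?sqr_ge0.
- exact: measurable_funeM.
- by move=> x _; rewrite -EFinM lee_fin mulr_ge0 ?sqr_ge0.
- exact: measurable_funeM.
rewrite !ge0_integralZl//; try by move=> x _; rewrite lee_fin sqr_ge0.
by rewrite lte_add_pinfty// lte_mul_pinfty.
Qed.

Lemma sq_integrableZ f (c : R) : sq_integrable f -> sq_integrable (fun x => c * f x).
Proof.
move=> sf; apply: (@sq_integrable_le _ f (c ^+ 2)) => //; first exact: sqr_ge0.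
  by case: sf => mf _; exact: measurable_funM.
by move=> x; rewrite exprMn.
Qed.

Lemma sq_integrableN f : sq_integrable f -> sq_integrable (fun x => - f x).
Proof.
by move=> /(sq_integrableZ (-1)); congr sq_integrable; apply/funext => x; rewrite mulN1r.
Qed.

Lemma sq_integrableB f g : sq_integrable f -> sq_integrable g ->
  sq_integrable (fun x => f x - g x).
Proof. by move=> sf sg; apply: sq_integrableD => //; exact: sq_integrableN. Qed.

Lemma sq_integrable_cst (c : R) : sq_integrable (fun=> c).
Proof.
split; first exact: measurable_cst.
by rewrite integral_cst//= probability_setT mule1 ltry.
Qed.

Lemma sq_integrable_sum I (r : seq I) (F : I -> T -> R) :
  (forall i, List.In i r -> sq_integrable (F i)) ->
  sq_integrable (fun x => \sum_(i <- r) F i x).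
Proof.
elim: r => [_|i r IH h].
  have -> : (fun x => \sum_(i <- [::]) F i x) = fun=> 0 by apply/funext => x; rewrite big_nil.
  exact: sq_integrable_cst.
have -> : (fun x => \sum_(j <- i :: r) F j x) = fun x => F i x + \sum_(j <- r) F j x.
  by apply/funext => x; rewrite big_cons.
by apply: sq_integrableD; [apply: h; left|apply: IH => j jr; apply: h; right].
Qed.

Lemma sq_integrable_indic f (A : set T) : measurable A -> sq_integrable f ->
  sq_integrable (fun x => \1_A x * f x).
Proof.
move=> mA sf; apply: (@sq_integrable_le _ f 1) => //.
  case: sf => mf _; apply: measurable_funM => //; exact: measurable_indic.
move=> x; rewrite mul1r indicE; case: (_ \in _); rewrite ?mul1r//.
by rewrite mul0r expr0n sqr_ge0.
Qed.

Lemma sq_integrableM f g : sq_integrable f -> sq_integrable g ->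
  P.-integrable setT (EFin \o (fun x => f x * g x)).
Proof.
move=> sf sg; have [mf f2] := sf; have [mg g2] := sg; apply/integrableP; split.
  by apply/measurable_EFinP; exact: measurable_funM.
apply: (@le_lt_trans _ _ (\int[P]_x ((f x ^+ 2)%:E + (g x ^+ 2)%:E))%E).
  apply: le_lower_integral => x _; first exact: abse_ge0.
  rewrite /= lee_fin ler_norml.
  have := sqr_ge0 (f x - g x); have := sqr_ge0 (f x + g x) => ? ?.
  by apply/andP; split; nra.
have mf2 : measurable_fun setT (fun x => (f x ^+ 2)%:E) by apply/measurable_EFinP; exact: measurable_funX.
have mg2 : measurable_fun setT (fun x => (g x ^+ 2)%:E) by apply/measurable_EFinP; exact: measurable_funX.
rewrite ge0_integralD//; try by move=> x _; rewrite lee_fin sqr_ge0.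
by rewrite lte_add_pinfty.
Qed.

Lemma sq_integrable_integrable f : sq_integrable f -> P.-integrable setT (EFin \o f).
Proof.
move=> sf; have := sq_integrableM sf (sq_integrable_cst 1).
by congr (_.-integrable _ _); apply/funext => x /=; rewrite mulr1.
Qed.

(** The inner product of L^2(P) on representatives. The real-valued integral has a default value
    where f g is not integrable, so additivity is stated under [sq_integrable]. *)
Definition ip2 f g : R := \int[P]_x (f x * g x).

Lemma ip2C f g : ip2 f g = ip2 g f.
Proof. by congr Rintegral; apply/funext => x; rewrite mulrC. Qed.

Lemma ip2Dl f g h : sq_integrable f -> sq_integrable g -> sq_integrable h ->
  ip2 (fun x => f x + g x) h = ip2 f h + ip2 g h.
Proof.
move=> sf sg sh; rewrite /ip2 -RintegralD//; try exact: sq_integrableM.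
by congr Rintegral; apply/funext => x; rewrite mulrDl.
Qed.

Lemma ip2Dr f g h : sq_integrable f -> sq_integrable g -> sq_integrable h ->
  ip2 h (fun x => f x + g x) = ip2 h f + ip2 h g.
Proof. by move=> sf sg sh; rewrite ip2C ip2Dl// !(ip2C h). Qed.

Lemma ip2_suml I (r : seq I) (F : I -> T -> R) h :
  (forall i, List.In i r -> sq_integrable (F i)) -> sq_integrable h ->
  ip2 (fun x => \sum_(i <- r) F i x) h = \sum_(i <- r) ip2 (F i) h.
Proof.
move=> + sh; elim: r => [_|i r IH sF].
  rewrite big_nil /ip2; under eq_Rintegral do rewrite big_nil mul0r.
  by rewrite /Rintegral integral0.
rewrite big_cons -IH => [|j jr]; last by apply: sF; right.
rewrite -ip2Dl//; last by apply: sq_integrable_sum => j jr; apply: sF; right.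
- by congr ip2; apply/funext => x; rewrite big_cons.
- by apply: sF; left.
Qed.

Lemma ip2_ge0 f : 0 <= ip2 f f.
Proof. by apply: Rintegral_ge0 => x _; rewrite -expr2 sqr_ge0. Qed.

Lemma integral_sqrE f : sq_integrable f -> (\int[P]_x (f x ^+ 2)%:E = (ip2 f f)%:E)%E.
Proof.
move=> sf; rewrite /ip2 /Rintegral; under [in RHS]eq_integral do rewrite -expr2.
rewrite fineK// fin_num_abs; case: sf => mf f2.
by rewrite gee0_abs// integral_ge0// => x _; rewrite lee_fin sqr_ge0.
Qed.

End SquareIntegrable.

Section Independence.
Context d (T : measurableType d) (R : realType).
Variable P : probability T R.

Lemma eq_law_integral_sqr (X Y : T -> R) :
  measurable_fun setT X -> measurable_fun setT Y ->
  (forall B, measurable B -> P (X @^-1` B) = P (Y @^-1` B)) ->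
  (\int[P]_x (X x ^+ 2)%:E = \int[P]_x (Y x ^+ 2)%:E)%E.
Proof.
move=> mX mY XY.
pose X' : {RV P >-> R} := mfun_Sub (mem_set mX).
pose Y' : {RV P >-> R} := mfun_Sub (mem_set mY).
have m2 : measurable_fun setT (fun r : R => (r ^+ 2)%:E).
  by apply/measurable_EFinP; exact: measurable_funX.
have s0 (r : R) : (0 <= (r ^+ 2)%:E)%E by rewrite lee_fin sqr_ge0.
have := ge0_integral_distribution X' m2 s0.
have := ge0_integral_distribution Y' m2 s0.
rewrite /= => <- <-; apply: eq_measure_integral => B mB _.
exact: XY.
Qed.

(** The joint law agrees with the product of the marginal laws on rectangles, hence everywhere;
    Fubini then factors the integral of [z.1 * z.2]. *)
Lemma indep_integralM (X Y : T -> R) :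
  P.-integrable setT (EFin \o X) -> P.-integrable setT (EFin \o Y) ->
  P.-integrable setT (EFin \o (fun x => X x * Y x)) ->
  (forall A B, measurable A -> measurable B ->
     P (X @^-1` A `&` Y @^-1` B) = P (X @^-1` A) * P (Y @^-1` B))%E ->
  \int[P]_x (X x * Y x) = (\int[P]_x X x) * (\int[P]_x Y x).
Proof.
move=> iX iY iXY XY.
have mX : measurable_fun setT X by apply/measurable_EFinP; case/integrableP: iX.
have mY : measurable_fun setT Y by apply/measurable_EFinP; case/integrableP: iY.
pose X' : {RV P >-> R} := mfun_Sub (mem_set mX).
pose Y' : {RV P >-> R} := mfun_Sub (mem_set mY).
have mXY : measurable_fun setT (fun x => (X x, Y x)) by exact: measurable_fun_pair.
pose XY' : {RV P >-> (R * R)%type} := mfun_Sub (mem_set mXY).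
pose mu := distribution P X'; pose nu := distribution P Y'.
have law A : measurable A -> (mu \x nu)%E A = distribution P XY' A.
  apply: product_measure_unique => B C mB mC.
  exact: XY.
pose m (z : R * R) := (z.1 * z.2)%:E.
have mm : measurable_fun setT m.
  by apply/measurable_EFinP; apply: measurable_funM.
have im : (mu \x nu)%E.-integrable setT m.
  apply/integrableP; split => //.
  rewrite (eq_measure_integral (distribution P XY')); last first.
    by move=> A mA _; exact: law.
  rewrite ge0_integral_distribution//; last exact: measurableT_comp.
  by case/integrableP: iXY.
have E1 : (\int[P]_x (X x * Y x)%:E = \int[(mu \x nu)%E]_z m z)%E.
  rewrite (eq_measure_integral (distribution P XY')); last first.
    by move=> A mA _; exact: law.
  by rewrite integral_distribution.
have IY : (\int[P]_x (Y x)%:E = \int[nu]_y y%:E)%E.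
  by rewrite integral_distribution.
have IX : (\int[P]_x (X x)%:E = \int[mu]_y y%:E)%E.
  by rewrite integral_distribution.
have iX' : mu.-integrable setT (EFin : R -> \bar R).
  by apply: integrable_pushforward.
have iY' : nu.-integrable setT (EFin : R -> \bar R).
  by apply: integrable_pushforward.
rewrite /Rintegral E1 -integral12_prod_meas1// IX IY /fubini_F /m /=.
have -> : (fun x : R => \int[nu]_y (x * y)%:E)%E = (fun x => x%:E * \int[nu]_y y%:E)%E.
  by apply/funext => x; rewrite -integralZl//.
have fY : (\int[nu]_y y%:E)%E \is a fin_num by apply: integrable_fin_num.
have fX : (\int[mu]_y y%:E)%E \is a fin_num by apply: integrable_fin_num.
rewrite -(fineK fY) integralZr// fineM//.
Qed.

End Independence.

(** Non-negativity makes g monotone. If k <= n t < k + 1, then n g(t) and n t g(1) both lie between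
    k g(1) and (k + 1) g(1); hence n |g(t) - t g(1)| <= g(1) for every n >= 1, which forces
    equality. *)
Lemma additive_ge0_linear {R : realType} (g : R -> R) :
  (forall t, 0 <= t -> 0 <= g t) ->
  (forall s t, 0 <= s -> 0 <= t -> g (s + t) = g s + g t) ->
  forall t, 0 <= t -> g t = t * g 1.
Proof.
move=> g0 gD t t0.
have g00 : g 0 = 0 by have := gD 0 0 (lexx 0) (lexx 0); rewrite addr0 => h; lra.
have gn s n : 0 <= s -> g (n%:R * s) = n%:R * g s.
  move=> s0; elim: n => [|n IH]; first by rewrite !mul0r.
  by rewrite -natr1 mulrDl mul1r gD ?mulr_ge0// IH mulrDl mul1r.
have g_mono s u : 0 <= s -> s <= u -> g s <= g u.
  by move=> s0 su; rewrite -(subrKC s u) gD ?subr_ge0// lerDl g0// subr_ge0.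
have bound n : `|n.+1%:R * (g t - t * g 1)| <= g 1.
  have nt0 : 0 <= n.+1%:R * t by rewrite mulr_ge0.
  have /andP[h1 h2] := truncn_itv nt0.
  set k := Num.truncn _ in h1 h2.
  have e1 : g k%:R = k%:R * g 1 by rewrite -(gn 1 k)// mulr1.
  have e2 : g k.+1%:R = k.+1%:R * g 1 by rewrite -(gn 1 k.+1)// mulr1.
  have := g_mono _ _ (ler0n R k) h1; have := g_mono _ _ nt0 (ltW h2).
  rewrite (gn _ n.+1)// e1 e2 -natr1 ler_norml => h3 h4.
  have g10 := g0 1 ler01.
  by apply/andP; split; nra.
apply/eqP; rewrite -subr_eq0 -normr_eq0 eq_le normr_ge0 andbT leNgt.
apply/negP => pos.
set D := `|_| in pos.
have := bound (Num.truncn (g 1 / D)); rewrite normrM ger0_norm// -/D leNgt.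
by rewrite -ltr_pdivrMr// truncnS_gt.
Qed.

(** [g_sigma_algebraType G] carries the sigma-algebra generated by [G], which is [G] itself when [G]
    is one; in this form the closure rules for measurable functions apply to each member of the
    filtration. *)
Definition sub_measurable {T : pointedType} {R : realType} (G : set (set T)) (f : T -> R) :=
  measurable_fun (setT : set (g_sigma_algebraType G)) (f : g_sigma_algebraType G -> R).

Lemma sub_measurableP {T : pointedType} {R : realType} (G : set (set T)) (f : T -> R) B :
  sigma_algebra setT G -> sub_measurable G f -> measurable B -> G (f @^-1` B).
Proof.
move=> sG mf mB; have := mf measurableT _ mB; rewrite setTI.
by rewrite [X in X _ -> _]measurable_g_measurableTypeE.
Qed.

Lemma sub_measurable_inner {T : pointedType} {R : realType} {V : hilbertType R}
    (G : set (set T)) (Z : T -> V) x :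
  sigma_algebra setT G -> (forall O : set V, open O -> G (Z @^-1` O)) ->
  sub_measurable G (fun w => inner (Z w) x).
Proof.
move=> sG mZ; apply: measurable_fun_opens => O oO; rewrite setTI.
rewrite [X in X _]measurable_g_measurableTypeE//.
apply: (mZ ((fun z => inner z x) @^-1` O)).
by apply: open_comp => // z _; exact: inner_continuous.
Qed.

Lemma sub_measurable_indic {T : pointedType} {R : realType} (G : set (set T)) A :
  sigma_algebra setT G -> G A -> @sub_measurable T R G (\1_A).
Proof.
move=> sG GA; apply: (@measurable_indic _ (g_sigma_algebraType G)).
by rewrite [X in X _]measurable_g_measurableTypeE.
Qed.

(** * Second moments of the increments of the Levy process *)

Section Levy.
Context {R : realType} {d : measure_display} {Omega : measurableType d}.
Variables (P : probability Omega R) (F : R -> set (set Omega)).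
Context {V : hilbertType R}.
Variables (L : R -> Omega -> V) (Q : V -> V).
Hypothesis hF : filtration F.
Hypothesis levyL : levy_process P F L.
Hypothesis sqL : square_integrable_process P L.
Hypothesis meanL : zero_mean P L.
Hypothesis hQ : covariance_op Q.
Hypothesis covL : has_covariance P L Q.

Definition incr (a b : R) (x : V) (w : Omega) : R := inner (L b w - L a w) x.

Lemma incrE a b x w : incr a b x w = inner (L b w) x - inner (L a w) x.
Proof. by rewrite /incr innerBl. Qed.

Lemma incr_cat b a c x w : incr a c x w = incr a b x w + incr b c x w.
Proof. by rewrite !incrE; ring. Qed.

Lemma incrDr a b x y w : incr a b (x + y) w = incr a b x w + incr a b y w.
Proof. exact: innerDr. Qed.

Lemma incr_nil a x w : incr a a x w = 0.
Proof. by rewrite /incr subrr inner0l. Qed.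

Lemma filtration_sigma (t : R) : 0 <= t -> sigma_algebra setT (F t).
Proof. by case: hF => + _ _; exact. Qed.

Lemma filtration_measurable (t : R) A : 0 <= t -> F t A -> measurable A.
Proof. by move=> t0; case: hF => _ + _; exact. Qed.

Lemma filtration_le (s t : R) A : 0 <= s -> s <= t -> F s A -> F t A.
Proof. by move=> s0 st; case: hF => _ _; exact. Qed.

Lemma sub_measurable_levy (s t : R) x : 0 <= s -> s <= t ->
  sub_measurable (F t) (fun w => inner (L s w) x).
Proof.
move=> s0 st; have t0 := le_trans s0 st; apply: sub_measurable_inner.
  exact: filtration_sigma.
by move=> O oO; apply: (filtration_le s0 st); case: levyL => _ + _ _ _; exact.
Qed.

Lemma sub_measurable_incr (a b t : R) x : 0 <= a -> a <= b -> b <= t ->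
  sub_measurable (F t) (incr a b x).
Proof.
move=> a0 ab bt.
have -> : incr a b x = (fun w => inner (L b w) x - inner (L a w) x).
  by apply/funext => w; rewrite incrE.
apply: measurable_funB; apply: sub_measurable_levy => //.
- exact: le_trans ab.
- exact: le_trans bt.
Qed.

Lemma sub_measurable_fun (t : R) (f : Omega -> R) : 0 <= t -> sub_measurable (F t) f ->
  measurable_fun (setT : set Omega) (f : Omega -> R).
Proof.
move=> t0 mf _ B mB; rewrite setTI; apply: (filtration_measurable t0).
exact: sub_measurableP (filtration_sigma t0) mf mB.
Qed.

Lemma sq_integrable_levy (t : R) x : 0 <= t -> sq_integrable P (fun w => inner (L t w) x).
Proof.
move=> t0; have mL := sub_measurable_fun t0 (sub_measurable_levy x t0 (lexx t)).
have mN : measurable_fun setT (fun w => `|L t w|).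
  apply: measurable_fun_opens => O oO; rewrite setTI; apply: (filtration_measurable t0).
  case: levyL => _ /(_ t t0 ((fun z => `|z|) @^-1` O)) + _ _ _; apply.
  by apply: open_comp => // z _; exact: norm_continuous.
apply: (@sq_integrable_le _ _ _ _ _ (fun w => `|L t w|) (`|x| ^+ 2)) => //.
- by split => //; exact: sqL.
- by move=> w; rewrite -!inner_norm mulrC cauchy_schwarz_sqr.
Qed.

Lemma sq_integrable_incr (a b : R) x : 0 <= a -> a <= b -> sq_integrable P (incr a b x).
Proof.
move=> a0 ab; have b0 := le_trans a0 ab.
have -> : incr a b x = (fun w => inner (L b w) x - inner (L a w) x).
  by apply/funext => w; rewrite incrE.
by apply: sq_integrableB; exact: sq_integrable_levy.
Qed.

Lemma integral_incr (a b : R) x : 0 <= a -> a <= b -> \int[P]_w incr a b x w = 0.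
Proof.
move=> a0 ab; have b0 := le_trans a0 ab.
under eq_Rintegral do rewrite incrE.
rewrite RintegralB//; try exact/sq_integrable_integrable/sq_integrable_levy.
by rewrite /Rintegral !meanL// subrr.
Qed.

(* The increment enters through a continuous function g, so that both a single
   coordinate and a product of two coordinates are covered. *)
Lemma indep_incr (a b : R) (Y : Omega -> R) (g : V -> R) (A B : set R) : 0 <= a -> a <= b ->
  sub_measurable (F a) Y -> continuous g -> measurable A -> measurable B ->
  (P (Y @^-1` A `&` (fun w => g (L b w - L a w)%R) @^-1` B) =
   P (Y @^-1` A) * P ((fun w => g (L b w - L a w)%R) @^-1` B))%E.
Proof.
move=> a0 ab mY cg mA mB; case: levyL => _ _ + _ _.
move=> /(_ a b (Y @^-1` A) (g @^-1` B) a0 ab); apply.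
  exact: sub_measurableP (filtration_sigma a0) mY mA.
have : measurable_fun (setT : set (g_sigma_algebraType (@open V))) g.
  apply: measurable_fun_opens => O oO; rewrite setTI; apply: sub_sigma_algebra.
  by apply: open_comp => // z _; exact: cg.
by move=> /(_ measurableT _ mB); rewrite setTI.
Qed.

(** The increment is independent of what is known at time a and has mean zero. Cross terms over
    non-overlapping times vanish by this orthogonality. *)
Lemma ip2_incr_past (a b : R) x (Y : Omega -> R) : 0 <= a -> a <= b ->
  sub_measurable (F a) Y -> sq_integrable P Y -> ip2 P Y (incr a b x) = 0.
Proof.
move=> a0 ab mY sY; have sI := sq_integrable_incr x a0 ab.
rewrite /ip2 indep_integralM ?integral_incr ?mulr0//.
- exact: sq_integrable_integrable.
- exact: sq_integrable_integrable.
- exact: sq_integrableM.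
- move=> A B mA mB; apply: (indep_incr (g := fun z => inner z x) a0 ab mY _ mA mB).
  exact: inner_continuous.
Qed.

(** Stationarity is applied to both sides. Comparing with an increment from 0, not with [L (b - a)],
    keeps [L 0 = 0], known only almost everywhere, out of the identity. *)
Lemma incr_law (a b : R) (x : V) (B : set R) : 0 <= a -> a <= b -> measurable B ->
  P (incr a b x @^-1` B) = P (incr 0 (b - a) x @^-1` B).
Proof.
move=> a0 ab mB.
have sB : <<s @open V >> ((fun z => inner z x) @^-1` B).
  have : measurable_fun (setT : set (g_sigma_algebraType (@open V))) (fun z => inner z x).
    apply: measurable_fun_opens => O oO; rewrite setTI; apply: sub_sigma_algebra.
    by apply: open_comp => // z _; exact: inner_continuous.
  by move=> /(_ measurableT _ mB); rewrite setTI.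
case: levyL => _ _ _ st _.
have ba0 : 0 <= b - a by rewrite subr_ge0.
rewrite [LHS](st a b _ a0 ab sB) [RHS](st 0 (b - a) _ (lexx 0) ba0 sB).
by rewrite subr0.
Qed.

Let gamma (x : V) (h : R) := ip2 P (incr 0 h x) (incr 0 h x).

Lemma ip2_incr_gamma (a b : R) x : 0 <= a -> a <= b ->
  ip2 P (incr a b x) (incr a b x) = gamma x (b - a).
Proof.
move=> a0 ab; have ba0 : 0 <= b - a by rewrite subr_ge0.
apply: EFin_inj; rewrite -!integral_sqrE; try exact: sq_integrable_incr.
apply: eq_law_integral_sqr => [||B mB].
- by have [] := sq_integrable_incr x a0 ab.
- by have [] := sq_integrable_incr x (lexx 0) ba0.
- exact: incr_law.
Qed.

(** Cutting the increment at s, the cross terms vanish by orthogonality to the past, and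
    stationarity moves the second piece back to time 0. *)
Lemma gammaD x (s t : R) : 0 <= s -> 0 <= t -> gamma x (s + t) = gamma x s + gamma x t.
Proof.
move=> s0 t0; have sst : s <= s + t by rewrite lerDl.
have s1 := sq_integrable_incr x (lexx 0) s0.
have s2 := sq_integrable_incr x s0 sst.
rewrite {1}/gamma.
have -> : incr 0 (s + t) x = fun w => incr 0 s x w + incr s (s + t) x w.
  by apply/funext => w; exact: incr_cat.
rewrite ip2Dl//; last exact: sq_integrableD.
rewrite !ip2Dr// [ip2 _ (incr s _ _) (incr 0 _ _)]ip2C.
rewrite !(@ip2_incr_past s (s + t) x (incr 0 s x))//; last exact: sub_measurable_incr.
by rewrite (ip2_incr_gamma x s0 sst) [s + t]addrC addrK addr0 add0r.
Qed.

(** The slope of the linear function [gamma x] is read off at length 1 from the covariance of [L 1];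
    this is where [L 0 = 0] almost everywhere enters. *)
Lemma ip2_incr_sqr (a b : R) x : 0 <= a -> a <= b ->
  ip2 P (incr a b x) (incr a b x) = (b - a) * inner (Q x) x.
Proof.
move=> a0 ab; rewrite ip2_incr_gamma// (@additive_ge0_linear _ (gamma x)).
- congr *%R; apply: EFin_inj; rewrite -covL /gamma -integral_sqrE; last first.
    exact: sq_integrable_incr.
  under [RHS]eq_integral do rewrite -expr2.
  apply: ae_eq_integral => //.
  + by apply/measurable_EFinP/measurable_funX; case: (sq_integrable_incr x (lexx 0) ler01).
  + by apply/measurable_EFinP/measurable_funX; case: (sq_integrable_levy x ler01).
  + case: levyL => L0 _ _ _ _; apply: filterS L0 => w L0w _ /=.
    by rewrite /incr L0w subr0.
- by move=> t _; exact: ip2_ge0.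
- exact: gammaD.
- by rewrite subr_ge0.
Qed.

(** Polarisation of [ip2_incr_sqr]; the symmetry of Q merges the two mixed terms. *)
Lemma ip2_incr (a b : R) x y : 0 <= a -> a <= b ->
  ip2 P (incr a b x) (incr a b y) = (b - a) * inner (Q x) y.
Proof.
move=> a0 ab; have := ip2_incr_sqr (x + y) a0 ab.
have -> : incr a b (x + y) = fun w => incr a b x w + incr a b y w.
  by apply/funext => w; exact: incrDr.
have [sx sy] := (sq_integrable_incr x a0 ab, sq_integrable_incr y a0 ab).
rewrite ip2Dl//; last exact: sq_integrableD.
rewrite !ip2Dr// !ip2_incr_sqr// (ip2C _ (incr a b y)).
case: hQ => -[lQ _] symQ _ _.
have -> : Q (x + y) = Q x + Q y by rewrite -[x in LHS]scale1r lQ scale1r.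
have -> : inner (Q x + Q y) (x + y) = inner (Q x) x + 2 * inner (Q x) y + inner (Q y) y.
  by rewrite !(innerDl, innerDr) (symQ y x) (innerC y); ring.
move=> h; lra.
Qed.

Lemma ip2_incr_indic (a b : R) x y A : 0 <= a -> a <= b -> F a A ->
  ip2 P (fun w => \1_A w * incr a b x w) (incr a b y) =
  fine (P A) * ((b - a) * inner (Q x) y).
Proof.
move=> a0 ab FA; have mA := filtration_measurable a0 FA.
have [sx sy] := (sq_integrable_incr x a0 ab, sq_integrable_incr y a0 ab).
rewrite -ip2_incr// /ip2; under eq_Rintegral do rewrite -mulrA.
have s1 : sq_integrable P (\1_A : Omega -> R).
  have := sq_integrable_indic mA (sq_integrable_cst P 1).
  by congr sq_integrable; apply/funext => w; rewrite mulr1.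
rewrite (@indep_integralM _ _ _ P (\1_A) (fun w => incr a b x w * incr a b y w)).
- congr *%R; rewrite /Rintegral.
  by rewrite integral_indic// setIT.
- exact: sq_integrable_integrable.
- exact: sq_integrableM.
- have := sq_integrableM (sq_integrable_indic mA sx) sy.
  by congr (_.-integrable _ _); apply/funext => w /=; rewrite mulrA.
- move=> B C mB mC.
  apply: (indep_incr (g := fun z => inner z x * inner z y) a0 ab _ _ mB mC).
    exact: sub_measurable_indic (filtration_sigma a0) FA.
  by move=> z; apply: cvgM; exact: inner_continuous.
Qed.

End Levy.

Lemma integral_sum_EFin d (T : measurableType d) (R : realType)
    (mu : {measure set T -> \bar R}) (D : set T) I (s : seq I)
    (f : I -> T -> R) (r : I -> R) : measurable D ->
  (forall i, List.In i s -> mu.-integrable D (EFin \o f i) /\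
     (\int[mu]_(x in D) (f i x)%:E = (r i)%:E)%E) ->
  mu.-integrable D (fun x => (\sum_(i <- s) f i x)%:E) /\
  (\int[mu]_(x in D) (\sum_(i <- s) f i x)%:E = (\sum_(i <- s) r i)%:E)%E.
Proof.
move=> mD; elim: s => [_|i s IH fr].
  under eq_fun do rewrite big_nil; rewrite big_nil integral0; split => //.
  exact: integrable0.
have [|h1 h2] := IH; first by move=> j js; apply: fr; right.
have [|h3 h4] := fr i; first by left.
have -> : (fun x => (\sum_(j <- i :: s) f j x)%:E) =
    ((EFin \o f i) \+ (fun x => (\sum_(j <- s) f j x)%:E))%E.
  by apply/funext => x; rewrite big_cons.
by split; [exact: integrableD|rewrite integralD// h2 big_cons EFinD -h4].
Qed.

Lemma eq_sum_In (R : nmodType) I (s : seq I) (f g : I -> R) :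
  (forall i, List.In i s -> f i = g i) -> \sum_(i <- s) f i = \sum_(i <- s) g i.
Proof.
elim: s => [_|i s IH fg]; first by rewrite !big_nil.
by rewrite !big_cons IH ?fg; [|left|move=> j js; apply: fg; right].
Qed.

Section Overlap.
Context {R : realType}.

(** The length of the intersection of []a, b]] and []a', b']]. *)
Definition overlap (a b a' b' : R) : R := Num.max 0 (Num.min b b' - Num.max a a').

Lemma overlapC a b a' b' : overlap a b a' b' = overlap a' b' a b.
Proof. by rewrite /overlap minC [Num.max a _]maxC. Qed.

Lemma overlap_nil t a' b' : overlap t t a' b' = 0.
Proof.
rewrite /overlap max_l// subr_le0 (@le_trans _ _ t)//; first by rewrite ge_min lexx.
by rewrite le_max lexx.
Qed.

Lemma overlap_integral (t lo hi lo' hi' k : R) : 0 <= lo -> 0 <= lo' ->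
  let f s := \1_(`]lo, hi] : set R) s * \1_(`]lo', hi'] : set R) s * k in
  lebesgue_measure.-integrable `[0, t] (EFin \o f) /\
  (\int[lebesgue_measure]_(s in `[0%R, t]) (f s)%:E =
   (overlap (Num.min lo t) (Num.min hi t) (Num.min lo' t) (Num.min hi' t) * k)%:E)%E.
Proof.
move=> lo0 lo'0 f.
pose I : set R := `]lo, hi] `&` `]lo', hi'].
have mI : measurable I by exact: measurableI.
have fE : EFin \o f = fun s => (k%:E * (\1_I s)%:E)%E.
  by apply/funext => s; rewrite /= /f -EFinM mulrC /I !indicE in_setI -mulnb natrM.
have iI : lebesgue_measure.-integrable `[0, t] (EFin \o (\1_I : R -> R)).
  apply/integrableP; split.
    by apply/measurable_EFinP; exact: measurable_indic.
  under eq_integral do rewrite /= ger0_norm//.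
  rewrite integral_indic//.
  apply: (@le_lt_trans _ _ (lebesgue_measure (`[0, t] : set R))).
    by apply: le_measure; rewrite ?inE//; exact: measurableI.
  by rewrite lebesgue_measure_itv /=; case: ifP => _; rewrite ?ltry// -EFinB ltry.
split; first by rewrite fE; exact: integrableZl.
have -> : (fun s => (f s)%:E) = EFin \o f by [].
rewrite fE integralZl// integral_indic//.
(* Capping the endpoints at t amounts to intersecting with [[0, t]]: an interval starting after t
   becomes the empty []t, t]], and [0 <= lo] keeps all points non-negative. *)
have -> : I `&` `[0, t] = `]Num.max (Num.min lo t) (Num.min lo' t),
    Num.min (Num.min hi t) (Num.min hi' t)]%classic.
  apply/seteqP; split=> s; rewrite /I /= !in_itv /= gt_max !le_min !gt_min.
    by case=> -[/andP[-> ->] /andP[-> ->]] /andP[_ ->].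
  move=> /andP[/andP[h1 h2] /andP[/andP[-> st] /andP[-> _]]].
  rewrite st !andbT; move: h1 h2; rewrite ![t < s]ltNge st !orbF => ls ls'.
  by rewrite ls ls' (le_trans lo0 (ltW ls)).
rewrite /= lebesgue_measure_itv /= lte_fin /overlap.
set M := Num.max _ _; set m := Num.min _ _.
by case: ltP => Mm; rewrite -?EFinB muleC; [rewrite max_r ?subr_ge0 ?ltW|rewrite max_l ?subr_le0].
Qed.

End Overlap.

(** * The isometry for scalar elementary integrals *)

Section Isometry.
Context {R : realType} {d : measure_display} {Omega : measurableType d}.
Variables (P : probability Omega R) (F : R -> set (set Omega)).
Context {V : hilbertType R}.
Variables (L : R -> Omega -> V) (Q : V -> V).
Hypothesis hF : filtration F.
Hypothesis levyL : levy_process P F L.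
Hypothesis sqL : square_integrable_process P L.
Hypothesis meanL : zero_mean P L.
Hypothesis hQ : covariance_op Q.
Hypothesis covL : has_covariance P L Q.
Local Notation incr := (incr L).

Let sI := @sq_integrable_incr _ _ _ P F V L hF levyL sqL.

Let mF := @filtration_measurable _ _ _ F hF.

Lemma ip2_incr_disjoint (a b c e : R) x y C :
  0 <= a -> a <= b -> b <= c -> c <= e -> F c C ->
  ip2 P (fun w => \1_C w * incr a b x w) (incr c e y) = 0.
Proof.
move=> a0 ab bc ce FC; have c0 := le_trans a0 (le_trans ab bc).
apply: (ip2_incr_past hF levyL sqL meanL) => //; last first.
  by apply: sq_integrable_indic; [exact: mF FC|exact: sI].
apply: measurable_funM.
  by apply: sub_measurable_indic => //; exact: (filtration_sigma hF).
exact: (sub_measurable_incr hF levyL).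
Qed.

(** By symmetry a <= a', so both events are known at a'. The increments are cut at a' and at the
    smaller right endpoint; only the common piece survives, the others being orthogonal to what
    precedes them. *)
Lemma ip2_incr_overlap (a b a' b' : R) x y (A A' : set Omega) :
  0 <= a -> a <= b -> 0 <= a' -> a' <= b' -> F a A -> F a' A' ->
  ip2 P (fun w => \1_A w * incr a b x w) (fun w => \1_A' w * incr a' b' y w) =
  fine (P (A `&` A')) * (overlap a b a' b' * inner (Q x) y).
Proof.
wlog aa' : a b a' b' x y A A' / a <= a'.
  move=> h a0 ab a'0 a'b' FA FA'; have [aa'|/ltW a'a] := leP a a'; first exact: h.
  rewrite ip2C setIC overlapC; have [_ sQ _ _] := hQ.
  by rewrite sQ innerC; exact: h.
move=> a0 ab a'0 a'b' FA FA'.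
pose C := A `&` A'.
have FC : F a' C.
  have sF := filtration_sigma hF a'0.
  have FaA : F a' A by exact: (filtration_le hF) FA.
  have -> : C = ~` (~` A `|` ~` A') by rewrite setCU !setCK.
  have FCC B : F a' B -> F a' (~` B) by case: sF => _ + _ FB => /(_ B FB); rewrite setTD.
  apply: (FCC); rewrite -bigcup2E; case: sF => F0 _; apply=> i.
  by case: i => [|[|i]] //=; exact: FCC.
have mC : measurable C := mF a'0 FC.
have -> : ip2 P (fun w => \1_A w * incr a b x w) (fun w => \1_A' w * incr a' b' y w) =
    ip2 P (fun w => \1_C w * incr a b x w) (incr a' b' y).
  congr Rintegral; apply/funext => w.
  by rewrite /C indicI /=; ring.
have sC u v z : 0 <= u -> u <= v -> sq_integrable P (fun w => \1_C w * incr u v z w).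
  by move=> u0 uv; apply: sq_integrable_indic => //; exact: sI.
rewrite /overlap [Num.max a a']max_r//.
have [ba'|a'b] := leP b a'.
  rewrite max_l ?subr_le0 ?ge_min ?ba'// mul0r mulr0.
  exact: ip2_incr_disjoint.
have aEa' : (fun w => \1_C w * incr a b x w) =
    fun w => \1_C w * incr a a' x w + \1_C w * incr a' b x w.
  by apply/funext => w; rewrite (incr_cat L a'); ring.
have a'b_ := ltW a'b.
rewrite aEa' ip2Dl; [|exact: sC|exact: sC|exact: sI].
rewrite (@ip2_incr_disjoint a a' a' b')// add0r.
have Fle e : a' <= e -> F e C by move=> a'e; exact: (filtration_le hF) FC.
have [bb'|b'b] := leP b b'.
  have -> : incr a' b' y = fun w => incr a' b y w + incr b b' y w.
    by apply/funext => w; exact: incr_cat.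
  have b0 := le_trans a'0 a'b_.
  rewrite ip2Dr; [|exact: sI|exact: sI|exact: sC].
  rewrite (@ip2_incr_disjoint a' b b b')//; last exact: Fle.
  rewrite addr0 max_r ?subr_ge0//.
  exact: (ip2_incr_indic hF levyL sqL meanL hQ covL).
have b'b_ := ltW b'b; have b'0 := le_trans a'0 a'b'.
have -> : (fun w => \1_C w * incr a' b x w) =
    fun w => \1_C w * incr a' b' x w + \1_C w * incr b' b x w.
  by apply/funext => w; rewrite (incr_cat L b'); ring.
rewrite ip2Dl; [|exact: sC|exact: sC|exact: sI].
(* Here the first increment is the longer one; swapping the roles of x and y puts the later piece in
   the second slot, as [ip2_incr_disjoint] requires. *)
have -> : ip2 P (fun w => \1_C w * incr b' b x w) (incr a' b' y) =
    ip2 P (fun w => \1_C w * incr a' b' y w) (incr b' b x).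
  by congr Rintegral; apply/funext => w; ring.
rewrite (@ip2_incr_disjoint a' b' b' b)//; last exact: Fle.
rewrite addr0 max_r ?subr_ge0//.
exact: (ip2_incr_indic hF levyL sqL meanL hQ covL).
Qed.

Variable E : hilbertType R.
Implicit Types (c : @elementary_term R d Omega V E) (ds : seq (@elementary_term R d Omega V E)).
Variable y : @elementary_term R d Omega V E -> V.

Definition scalar_integral ds (t : R) (w : Omega) : R :=
  \sum_(c <- ds) \1_(et_event c) w *
    incr (Num.min (et_lo c) t) (Num.min (et_hi c) t) (y c) w.

(** When [y c] is the adjoint of [et_op c] at f, this vector represents the functional sending v to
    the f-coordinate of the elementary process at v. *)
Definition riesz_process ds (s : R) (w : Omega) : V :=
  \sum_(c <- ds) (\1_(`]et_lo c, et_hi c] : set R) s * \1_(et_event c) w) *: y c.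

Lemma wf_term_event c : wf_term F c -> measurable (et_event c).
Proof. by case=> lo0 _ + _; exact: mF. Qed.

Lemma sq_integrable_scalar_term c (t : R) : 0 <= t -> wf_term F c ->
  sq_integrable P (fun w => \1_(et_event c) w *
    incr (Num.min (et_lo c) t) (Num.min (et_hi c) t) (y c) w).
Proof.
move=> t0 wc; have mA := wf_term_event wc; case: wc => lo0 lohi _ _.
apply: sq_integrable_indic => //; apply: sI; first by rewrite le_min lo0.
by rewrite le_min !ge_min lohi lexx orbT.
Qed.

Lemma ip2_scalar_term c c' (t : R) : 0 <= t -> wf_term F c -> wf_term F c' ->
  ip2 P (fun w => \1_(et_event c) w *
           incr (Num.min (et_lo c) t) (Num.min (et_hi c) t) (y c) w)
        (fun w => \1_(et_event c') w *
           incr (Num.min (et_lo c') t) (Num.min (et_hi c') t) (y c') w) =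
  fine (P (et_event c `&` et_event c')) *
    (overlap (Num.min (et_lo c) t) (Num.min (et_hi c) t)
       (Num.min (et_lo c') t) (Num.min (et_hi c') t) * inner (Q (y c)) (y c')).
Proof.
move=> t0 wc wc'; have [lo0 lohi FA _] := wc; have [lo0' lohi' FA' _] := wc'.
(* [ip2_incr_overlap] needs each event to be known at the capped left endpoint. This may fail for a
   term starting after t, but then both endpoints are capped to t and its increment is zero. *)
have late c1 : wf_term F c1 -> t < et_lo c1 ->
    Num.min (et_lo c1) t = t /\ Num.min (et_hi c1) t = t.
  move=> [_ lh _ _] tlo; split; apply: min_r; first exact: ltW.
  exact: le_trans (ltW tlo) lh.
have [lot|tlo] := leP (et_lo c) t; last first.
  have [_ ->] := late c wc tlo; rewrite overlap_nil mul0r mulr0 /ip2.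
  under eq_Rintegral do rewrite incr_nil mulr0 mul0r.
  by rewrite /Rintegral integral0.
have [lot'|tlo'] := leP (et_lo c') t; last first.
  have [_ ->] := late c' wc' tlo'; rewrite overlapC overlap_nil mul0r mulr0 /ip2.
  under eq_Rintegral do rewrite incr_nil !mulr0.
  by rewrite /Rintegral integral0.
by rewrite ip2_incr_overlap// le_min ?lohi ?lohi'.
Qed.

(** Both sides are double sums over pairs of terms. The overlap length arises on the left from
    second moments of increments, on the right from the time integral of two indicators. *)
Lemma scalar_isometry ds (t : R) : 0 <= t -> List.Forall (@wf_term R d Omega F V E) ds ->
  (\int[P]_w (scalar_integral ds t w ^+ 2)%:E =
   \int[P]_w \int[lebesgue_measure]_(s in `[0%R, t])
      (inner (Q (riesz_process ds s w)) (riesz_process ds s w))%:E)%E.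
Proof.
move=> t0 /List.Forall_forall wds.
have sT c : List.In c ds -> _ := fun h => sq_integrable_scalar_term t0 (wds c h).
have sS : sq_integrable P (scalar_integral ds t) by exact: sq_integrable_sum.
have lQ : forall I (r : seq I) (a : I -> R) (v : I -> V),
    Q (\sum_(i <- r) a i *: v i) = \sum_(i <- r) a i *: Q (v i).
  move=> I r a v; case: hQ => bQ _ _ _; have [lQ _] := bQ.
  elim: r => [|i r IH]; first by rewrite !big_nil (bounded_linear0 bQ).
  by rewrite !big_cons lQ IH.
pose ov c c' := overlap (Num.min (et_lo c) t) (Num.min (et_hi c) t)
       (Num.min (et_lo c') t) (Num.min (et_hi c') t).
have inE w : (\int[lebesgue_measure]_(s in `[0%R, t])
      (inner (Q (riesz_process ds s w)) (riesz_process ds s w))%:E =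
    (\sum_(c <- ds) \sum_(c' <- ds)
      \1_(et_event c `&` et_event c') w * (ov c c' * inner (Q (y c)) (y c')))%:E)%E.
  pose f c c' s : R := \1_(`]et_lo c, et_hi c] : set R) s *
    \1_(`]et_lo c', et_hi c'] : set R) s *
    (\1_(et_event c `&` et_event c') w * inner (Q (y c)) (y c')).
  have -> : (fun s => (inner (Q (riesz_process ds s w)) (riesz_process ds s w))%:E) =
      (fun s => (\sum_(c <- ds) \sum_(c' <- ds) f c c' s)%:E).
    apply/funext => s; congr EFin; rewrite /riesz_process lQ inner_suml; apply: eq_bigr => c _.
    rewrite inner_sumr; apply: eq_bigr => c' _.
    by rewrite innerZl innerZr /f indicI /=; ring.
  apply: (integral_sum_EFin _ _).2 => // c dc.
  apply: integral_sum_EFin => // c' dc'.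
  have [[lo0 _ _ _] [lo0' _ _ _]] := (wds c dc, wds c' dc').
  have [h1 h2] := overlap_integral t (et_hi c) (et_hi c')
    (\1_(et_event c `&` et_event c') w * inner (Q (y c)) (y c')) lo0 lo0'.
  by split=> //; rewrite h2; congr EFin; rewrite /ov; ring.
under [RHS]eq_integral do rewrite inE.
rewrite integral_sqrE// {1}/scalar_integral ip2_suml//.
have -> : (\int[P]_w (\sum_(c <- ds) \sum_(c' <- ds)
    \1_(et_event c `&` et_event c') w * (ov c c' * inner (Q (y c)) (y c')))%:E =
   (\sum_(c <- ds) \sum_(c' <- ds)
    fine (P (et_event c `&` et_event c')) * (ov c c' * inner (Q (y c)) (y c')))%:E)%E.
  apply: (integral_sum_EFin _ _).2 => // c dc.
  apply: integral_sum_EFin => // c' dc'.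
  have mcc' : measurable (et_event c `&` et_event c').
    by apply: measurableI; apply: wf_term_event; exact: wds.
  set k := ov c c' * _.
  have ik : P.-integrable setT (fun w => (k%:E * (\1_(et_event c `&` et_event c') w)%:E)%E).
    by apply: integrableZl => //; exact: integrable_indic.
  have fE : (fun w => (\1_(et_event c `&` et_event c') w * k)%:E) =
      (fun w => (k%:E * (\1_(et_event c `&` et_event c') w)%:E)%E).
    by apply/funext => w; rewrite -EFinM mulrC.
  rewrite -[EFin \o _]/(fun w => (\1_(et_event c `&` et_event c') w * k)%:E) fE; split => //.
  rewrite integralZl//; last exact: integrable_indic.
  rewrite integral_indic// setIT [RHS]EFinM fineK 1?muleC// fin_num_measure//.
congr EFin.
apply: eq_sum_In => c dc.
rewrite ip2C ip2_suml//; last exact: sT.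
by apply: eq_sum_In => c' dc'; rewrite ip2C ip2_scalar_term//; exact: wds.
Qed.

End Isometry.

(** * Joint measurability and iterated integrals *)

Section Predictable.
Context {R : realType} {d : measure_display} {Omega : measurableType d}.
Variable F : R -> set (set Omega).
Hypothesis hF : filtration F.

Lemma predictable_set_measurable : predictable_set F `<=` (measurable : set (set (R * Omega))).
Proof.
have mD : measurable (`[0, +oo[ `*` setT : set (R * Omega)) by exact: measurableX.
apply: smallest_sub.
  split; [exact: measurable0|by move=> B mB; exact: measurableD|].
  by move=> G mG; exact: bigcupT_measurable.
move=> _ [[B FB ->]|[s [u [B [s0 su FB ->]]]]]; apply: measurableX => //.
- exact: filtration_measurable FB.
- exact: filtration_measurable FB.
Qed.

Lemma measurable_predictable (H : hilbertType R) (f : R -> Omega -> H) (x : H) (t : R) :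
  predictable F (fun s w => if s <= t then f s w else 0) ->
  measurable_fun (`[0, t] `*` setT : set (R * Omega)) (fun p => inner (f p.1 p.2) x).
Proof.
move=> pf; apply: measurable_fun_opens => O oO.
have -> : (`[0, t] `*` setT) `&` (fun p => inner (f p.1 p.2) x) @^-1` O =
    (`[0, t] `*` setT) `&` [set p | 0 <= p.1 /\
       ((fun z => inner z x) @^-1` O) (if p.1 <= t then f p.1 p.2 else 0)].
  apply/seteqP; split=> -[s w] [[+ _]]; rewrite /= in_itv /= => /andP[s0 st].
    by rewrite s0 st.
  by rewrite s0 st => -[_ Ox].
apply: measurableI; first exact: measurableX.
apply: predictable_set_measurable; apply: (pf ((fun z => inner z x) @^-1` O)).
by apply: open_comp => // z _; exact: inner_continuous.
Qed.

Lemma measurable_elementary (V E : hilbertType R) (cs : seq (@elementary_term R d Omega V E))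
    (v : V) (x : E) : List.Forall (@wf_term R d Omega F V E) cs ->
  measurable_fun setT (fun p : R * Omega => inner (elementary_process cs p.1 p.2 v) x).
Proof.
elim: cs => [_|c cs IH /List.Forall_cons_iff[wc /IH{}IH]].
  have -> : (fun p : R * Omega => inner (elementary_process [::] p.1 p.2 v) x) = fun=> 0.
    by apply/funext => p; rewrite /elementary_process big_nil inner0l.
  exact: measurable_cst.
have -> : (fun p : R * Omega => inner (elementary_process (c :: cs) p.1 p.2 v) x) =
    fun p => \1_(`]et_lo c, et_hi c] : set R) p.1 * (\1_(et_event c) p.2 * inner (et_op c v) x)
      + inner (elementary_process cs p.1 p.2 v) x.
  by apply/funext => p; rewrite /elementary_process big_cons innerDl !innerZl.
have mA : measurable (et_event c) by case: wc => lo0 _ + _; exact: filtration_measurable.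
apply: measurable_funD => //; apply: measurable_funM.
  by apply: (measurableT_comp (measurable_indic _)).
apply: measurable_funM => //.
by apply: (measurableT_comp (measurable_indic _)).
Qed.

End Predictable.

Section IteratedIntegral.
Context {R : realType} {d : measure_display} {Omega : measurableType d}.
Variable P : probability Omega R.
Local Open Scope ereal_scope.

(** Joint measurability is essential here: by Tonelli, after extension by zero outside [[0, t]], it
    makes the inner integrals measurable in w, so that the outer integral is additive. *)
Lemma iterated_integralD (t : R) (f g : R * Omega -> \bar R) (k : R) : (0 <= k)%R ->
  measurable_fun (`[0%R, t] `*` setT) f -> measurable_fun (`[0%R, t] `*` setT) g ->
  (forall p, 0 <= f p) -> (forall p, 0 <= g p) ->
  \int[P]_w \int[lebesgue_measure]_(s in `[0%R, t]) (k%:E * (f (s, w) + g (s, w))) =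
  k%:E * (\int[P]_w (\int[lebesgue_measure]_(s in `[0%R, t]) f (s, w)) +
          \int[P]_w (\int[lebesgue_measure]_(s in `[0%R, t]) g (s, w))).
Proof.
move=> k0 mf mg f0 g0.
have mD : measurable (`[0%R, t] `*` setT : set (R * Omega)) by exact: measurableX.
have restr (h : R * Omega -> \bar R) w :
    \int[lebesgue_measure]_(s in `[0%R, t]) h (s, w) =
    \int[lebesgue_measure]_s (h \_ (`[0%R, t] `*` setT)) (s, w).
  rewrite integral_mkcond; apply: eq_integral => s _.
  rewrite !patchE; congr (if _ then _ else _); apply/idP/idP; rewrite !inE //=.
  by case.
have mi (h : R * Omega -> \bar R) : measurable_fun (`[0%R, t] `*` setT) h ->
    (forall p, 0 <= h p) ->
    measurable_fun setT (fun w => \int[lebesgue_measure]_(s in `[0%R, t]) h (s, w)).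
  move=> mh h0; under eq_fun do rewrite restr.
  apply: (@measurable_fun_fubini_tonelli_G _ _ _ _ _ lebesgue_measure).
    exact/(measurable_restrictT _ mD).
  by move=> p; exact: erestrict_ge0.
have sect (h : R * Omega -> \bar R) w : measurable_fun (`[0%R, t] `*` setT) h ->
    measurable_fun `[0%R, t] (fun s => h (s, w)).
  move=> mh; apply/measurable_restrictT => //.
  have -> : (fun s => h (s, w)) \_ `[0%R, t] = fun s => (h \_ (`[0%R, t] `*` setT)) (s, w).
    apply/funext => s; rewrite !patchE; congr (if _ then _ else _).
    by apply/idP/idP; rewrite !inE //=; case.
  have /measurable_restrictT : measurable_fun (`[0%R, t] `*` setT) h by [].
  by move=> /(_ mD) mh'; exact: (measurableT_comp mh').
rewrite -ge0_integralD//; [|by move=> w _; exact: integral_ge0|exact: mi|by move=> w _; exact: integral_ge0|exact: mi].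
rewrite -ge0_integralZl//; last 2 first.
- by apply: emeasurable_funD; exact: mi.
- by move=> w _; apply: adde_ge0; exact: integral_ge0.
apply: eq_integral => w _; rewrite ge0_integralZl//; last 2 first.
- by apply: emeasurable_funD; exact: sect.
- by move=> s _; exact: adde_ge0.
by rewrite ge0_integralD//; exact: sect.
Qed.

End IteratedIntegral.

(** * Coordinates of elementary processes and of their integrals *)

Section RieszVector.
Context {R : realType} {V H : hilbertType R}.

Definition adjoint_at (A : V -> H) (f : H) : V :=
  xget 0 [set y | forall x, inner (A x) f = inner x y].

Lemma adjoint_atP (A : V -> H) f x : separable V -> bounded_linear A ->
  inner (A x) f = inner x (adjoint_at A f).
Proof.
move=> sV bA; have [e eP _] := onb_seq sV.
suff [y hy] : exists y, forall x, inner (A x) f = inner x y.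
  by rewrite /adjoint_at; case: xgetP => [z _ ->//|/(_ y)/(_ hy)].
apply: (riesz_representation eP); have [lA _] := bA.
have [M M0 AM] := bounded_linear_bound bA.
split=> [a u v|]; first by rewrite lA innerPl.
exists (M * `|f|) => z; rewrite (le_trans (cauchy_schwarz _ _))//.
by rewrite mulrAC ler_wpM2r.
Qed.

End RieszVector.

Section Elementary.
Context {R : realType} {d : measure_display} {Omega : measurableType d}.
Variables (F : R -> set (set Omega)).
Context {V E H : hilbertType R}.
Variable L : R -> Omega -> V.
Hypothesis sepV : separable V.

Definition map_term (T : E -> H) (c : @elementary_term R d Omega V E) :
    @elementary_term R d Omega V H :=
  ElementaryTerm (et_lo c) (et_hi c) (et_event c) (T \o et_op c).

Lemma wf_map_term (T : E -> H) c : bounded_linear T ->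
  wf_term F c -> wf_term F (map_term T c).
Proof. by move=> bT [h1 h2 h3 h4]; split=> //=; exact: bounded_linear_comp. Qed.

Lemma wf_map_terms (T : E -> H) cs : bounded_linear T ->
  List.Forall (@wf_term R d Omega F V E) cs ->
  List.Forall (@wf_term R d Omega F V H) [seq map_term T c | c <- cs].
Proof.
move=> bT; elim: cs => [//|c cs IH] /List.Forall_cons_iff[wc wcs].
by constructor; [exact: wf_map_term|exact: IH].
Qed.

Lemma elementary_process_map (T : E -> H) cs s w v : bounded_linear T ->
  elementary_process [seq map_term T c | c <- cs] s w v = T (elementary_process cs s w v).
Proof.
move=> bT; have [lT _] := bT; rewrite /elementary_process big_map.
elim: cs => [|c cs IH]; first by rewrite !big_nil (bounded_linear0 bT).
rewrite !big_cons IH lT; congr (_ *: _ + _).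
by rewrite -[_ *: et_op c v]addr0 lT (bounded_linear0 bT) addr0.
Qed.

Lemma elementary_integral_map (T : E -> H) cs t w : bounded_linear T ->
  elementary_integral L [seq map_term T c | c <- cs] t w = T (elementary_integral L cs t w).
Proof.
move=> bT; have [lT _] := bT; rewrite /elementary_integral big_map.
elim: cs => [|c cs IH]; first by rewrite !big_nil (bounded_linear0 bT).
by rewrite !big_cons IH lT.
Qed.

(** Supplies the vanishing at 0 under which the Hilbert-Schmidt sum over the basis may be rewritten
    along the sequence [e]. *)
Lemma bounded_linear_elementary cs s w : List.Forall (@wf_term R d Omega F V E) cs ->
  elementary_process cs s w 0 = 0.
Proof.
move=> /List.Forall_forall wcs; rewrite /elementary_process.
rewrite (eq_sum_In (g := fun=> 0)) ?big1// => c cc.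
by have [_ _ _ bA] := wcs c cc; rewrite (bounded_linear0 bA) !scaler0.
Qed.

Lemma inner_elementary_process cs s w v (f : E) :
  List.Forall (@wf_term R d Omega F V E) cs ->
  inner (elementary_process cs s w v) f =
  inner v (riesz_process (fun c => adjoint_at (et_op c) f) cs s w).
Proof.
move=> /List.Forall_forall wcs; rewrite inner_suml inner_sumr.
apply: eq_sum_In => c cc; have [_ _ _ bA] := wcs c cc.
by rewrite !innerZl innerZr /= -adjoint_atP// mulrA.
Qed.

Lemma inner_elementary_integral cs t w (f : E) :
  List.Forall (@wf_term R d Omega F V E) cs ->
  inner (elementary_integral L cs t w) f =
  scalar_integral L (fun c => adjoint_at (et_op c) f) cs t w.
Proof.
move=> /List.Forall_forall wcs; rewrite inner_suml.
apply: eq_sum_In => c cc; have [_ _ _ bA] := wcs c cc.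
by rewrite innerZl /incr /= -adjoint_atP.
Qed.

End Elementary.

(** With [map_term], negation lets a difference of two elementary processes be written as one, by
    concatenation. *)
Lemma bounded_linear_opp {R : realType} (H : hilbertType R) :
  bounded_linear (fun x : H => - x).
Proof.
split=> [a x y|]; first by rewrite opprD scalerN.
by exists 1 => x; rewrite normrN mul1r.
Qed.

(** * Coordinate energy and the isometry for operator-valued elementary processes *)

Section CoordinateEnergy.
Context {R : realType} {d : measure_display} {Omega : measurableType d}.
Variables (P : probability Omega R) (F : R -> set (set Omega)).
Context {V : hilbertType R}.
Variables (L : R -> Omega -> V) (Q Qh : V -> V).
Hypothesis sepV : separable V.
Hypothesis hF : filtration F.
Hypothesis levyL : levy_process P F L.
Hypothesis sqL : square_integrable_process P L.
Hypothesis meanL : zero_mean P L.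
Hypothesis hQ : covariance_op Q.
Hypothesis covL : has_covariance P L Q.
Hypothesis hQh : is_sqrt_op Q Qh.

Lemma sqrt_op0 : Qh 0 = 0.
Proof. by case: hQh => bQ _ _ _; exact: bounded_linear0. Qed.

Lemma sq_integrable_elementary (E : hilbertType R) (cs : seq (@elementary_term R d Omega V E))
    (t : R) (f : E) : 0 <= t -> List.Forall (@wf_term R d Omega F V E) cs ->
  sq_integrable P (fun w => inner (elementary_integral L cs t w) f).
Proof.
move=> t0 wcs; under eq_fun do rewrite (inner_elementary_integral L sepV _ _ _ wcs).
apply: sq_integrable_sum => c cc.
apply: (sq_integrable_scalar_term hF levyL sqL (fun c => adjoint_at (et_op c) f) t0).
by move/List.Forall_forall: wcs; exact.
Qed.

Variables (e : nat -> V).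
Hypothesis eP : complete_orthoseq e.
Hypothesis hs_e : forall a : V -> \bar R, a 0 = 0%E -> (forall x, 0 <= a x)%E ->
    (\esum_(x in @onb R V) a x = \sum_(k <oo) (a (e k)))%E.

(** For bounded linear [A] this is the squared norm of [Qh] applied to the adjoint of [A] at f,
    written in coordinates so that measurability can be checked term by term. *)
Definition coord_energy (H : hilbertType R) (A : V -> H) (f : H) : \bar R :=
  (\sum_(k <oo) (inner (A (Qh (e k))) f ^+ 2)%:E)%E.

Lemma coord_energy_ge0 (H : hilbertType R) (A : V -> H) f : (0 <= coord_energy A f)%E.
Proof. by apply: nneseries_ge0 => k _ _; rewrite lee_fin sqr_ge0. Qed.

(** [A] and [B] may have different target spaces: an error T B in H is thus bounded directly by the
    Hilbert-Schmidt norm of B in E. *)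
Lemma coord_energy_le_hs (E H : hilbertType R) (A : V -> H) (B : V -> E) f :
  B 0 = 0 -> (forall v, inner (A v) f ^+ 2 <= `|B v| ^+ 2) ->
  (coord_energy A f <= hs_norm2 (fun v => B (Qh v)))%E.
Proof.
move=> B0 AB; rewrite /hs_norm2 hs_e; last 2 first.
- by rewrite sqrt_op0 B0 normr0 expr0n.
- by move=> x; rewrite lee_fin sqr_ge0.
by apply: lee_nneseries => k _; rewrite ?lee_fin ?sqr_ge0.
Qed.

Lemma coord_energyB (H : hilbertType R) (A B : V -> H) f :
  (coord_energy (fun v => (A v - B v)%R) f <= 2%:E * (coord_energy A f + coord_energy B f))%E.
Proof.
rewrite /coord_energy -nneseriesD; try by move=> *; rewrite lee_fin sqr_ge0.
rewrite -nneseriesZl; last by move=> *; rewrite -EFinD lee_fin addr_ge0 ?sqr_ge0.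
apply: lee_nneseries => k _; rewrite ?lee_fin ?sqr_ge0// innerBl.
set p := inner _ _; set q := inner _ _; have := sqr_ge0 (p + q); nra.
Qed.

(* Parseval on the adjoint side: <Qh v, Psi> = <v, Qh Psi>. *)
Lemma coord_energy_elementary (H : hilbertType R) (cs : seq (@elementary_term R d Omega V H))
    s w f : List.Forall (@wf_term R d Omega F V H) cs ->
  let Psi := riesz_process (fun c => adjoint_at (et_op c) f) cs s w in
  ((inner (Q Psi) Psi)%:E = coord_energy (elementary_process cs s w) f)%E.
Proof.
move=> wcs Psi; have [_ symQh _ QhQh] := hQh.
rewrite -QhQh symQh inner_norm (parseval eP); apply: eq_eseriesr => k _.
by rewrite (inner_elementary_process sepV _ _ _ _ wcs) [in RHS]symQh innerC.
Qed.

Lemma elementary_isometry (H : hilbertType R) (cs : seq (@elementary_term R d Omega V H))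
    (t : R) f : 0 <= t -> List.Forall (@wf_term R d Omega F V H) cs ->
  (\int[P]_w (inner (elementary_integral L cs t w) f ^+ 2)%:E =
   \int[P]_w \int[lebesgue_measure]_(s in `[0%R, t])
     coord_energy (elementary_process cs s w) f)%E.
Proof.
move=> t0 wcs; under eq_integral do rewrite (inner_elementary_integral L sepV _ _ _ wcs).
rewrite (scalar_isometry hF levyL sqL meanL hQ covL)//.
by apply: eq_integral => w _; apply: eq_integral => s _; rewrite coord_energy_elementary.
Qed.

Lemma measurable_coord_energy (H : hilbertType R) (G : R -> Omega -> V -> H) (t : R) f :
  (forall v, measurable_fun (`[0, t] `*` setT : set (R * Omega))
     (fun p => inner (G p.1 p.2 v) f)) ->
  measurable_fun (`[0, t] `*` setT : set (R * Omega)) (fun p => coord_energy (G p.1 p.2) f).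
Proof.
move=> mG; apply: ge0_emeasurable_sum => [k p _ _|k _]; first by rewrite lee_fin sqr_ge0.
by apply/measurable_EFinP; apply: measurable_funX.
Qed.

End CoordinateEnergy.

Lemma measurable_borel_comp d (Omega : measurableType d) (R : realType)
    (E : topologicalType) (Z : Omega -> E) (g : E -> R) :
  borel_measurable measurable Z -> continuous g -> measurable_fun setT (fun w => g (Z w)).
Proof.
move=> mZ cg; apply: measurable_fun_opens => O oO; rewrite setTI.
by apply: (mZ (g @^-1` O)); apply: open_comp => // z _; exact: cg.
Qed.

Lemma measurable_innerB d (T : measurableType d) (R : realType) (H : hilbertType R)
    (D : set T) (A B : T -> H) (f : H) :
  measurable_fun D (fun x => inner (A x) f) -> measurable_fun D (fun x => inner (B x) f) ->
  measurable_fun D (fun x => inner (A x - B x) f).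
Proof.
move=> mA mB.
rewrite (_ : (fun _ => _) = fun x => inner (A x) f - inner (B x) f).
  exact: measurable_funB.
by apply/funext => x; exact: innerBl.
Qed.

(** * Uniqueness of stochastic integrals under an intertwining operator *)

Section Uniqueness.
Context {R : realType} {d : measure_display} {Omega : measurableType d}.
Variables (P : probability Omega R) (F : R -> set (set Omega)).
Context {V E H : hilbertType R}.
Variables (L : R -> Omega -> V) (Q Qh : V -> V).
Hypothesis sepV : separable V.
Hypothesis hF : filtration F.
Hypothesis levyL : levy_process P F L.
Hypothesis sqL : square_integrable_process P L.
Hypothesis meanL : zero_mean P L.
Hypothesis hQ : covariance_op Q.
Hypothesis covL : has_covariance P L Q.
Hypothesis hQh : is_sqrt_op Q Qh.

Variables (T : E -> H) (t : R) (Phi : R -> Omega -> V -> E)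
  (Psi : R -> Omega -> V -> H) (Z : Omega -> E) (X : Omega -> H).
Hypothesis t0 : 0 <= t.
Hypothesis bT : bounded_linear T.
Hypothesis TPhi : forall s w v, 0 <= s -> s <= t -> T (Phi s w v) = Psi s w v.
Hypothesis siZ : stochastic_integral P F L Qh Phi t Z.
Hypothesis siX : stochastic_integral P F L Qh Psi t X.

(** The two bounds on f make its coordinate a contraction on H and, through T, on E, so no constants
    from f or T appear in the estimates. *)
Lemma stochastic_integral_coord (f : H) : `|f| <= 1 ->
  (forall v, inner (T v) f ^+ 2 <= `|v| ^+ 2) ->
  {ae P, forall w, inner (X w - T (Z w)) f = 0}.
Proof.
move=> f1 Tf; have [e eP hs_e] := onb_seq sepV.
case: siZ => bPhi _ _ mZ [cs [wcs Ncs Ics]].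
case: siX => bPsi pPsi _ mX [cs' [wcs' Ncs' Ics']].
have f_le (x : H) : inner x f ^+ 2 <= `|x| ^+ 2.
  rewrite (le_trans (cauchy_schwarz_sqr _ _))// !inner_norm ler_piMr ?sqr_ge0//.
  by rewrite expr_le1.
pose ds n := [seq map_term T c | c <- cs n] ++ [seq map_term (fun x : H => - x) c | c <- cs' n].
have wds n : List.Forall (@wf_term R d Omega F V H) (ds n).
  apply/List.Forall_app; split; apply: wf_map_terms => //.
  exact: bounded_linear_opp.
have dsI n w : elementary_integral L (ds n) t w =
    T (elementary_integral L (cs n) t w) - elementary_integral L (cs' n) t w.
  rewrite {1}/elementary_integral big_cat/= -(elementary_integral_map L _ _ _ bT).
  by rewrite -(elementary_integral_map L _ _ _ (@bounded_linear_opp R H)).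
have dsP n s w v : elementary_process (ds n) s w v =
    T (elementary_process (cs n) s w v) - elementary_process (cs' n) s w v.
  rewrite {1}/elementary_process big_cat/= -(elementary_process_map _ _ _ _ bT).
  by rewrite -(elementary_process_map _ _ _ _ (@bounded_linear_opp R H)).
pose D w := inner (X w - T (Z w)) f.
have mXf : measurable_fun setT (fun w => inner (X w) f).
  by apply: (measurable_borel_comp (g := fun z => inner z f) mX); exact: inner_continuous.
have mTZf : measurable_fun setT (fun w => inner (T (Z w)) f).
  apply: (measurable_borel_comp (g := fun z => inner (T z) f) mZ) => z.
  apply: (@continuous_comp _ _ _ T (fun z => inner z f)).
    exact: bounded_linear_continuous.
  exact: inner_continuous.
have mD : measurable_fun setT D.
  exact: measurable_innerB.
pose e1 n := (\int[P]_w (`|elementary_integral L (cs n) t w - Z w| ^+ 2)%:E)%E.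
pose e2 n := (\int[P]_w (`|elementary_integral L (cs' n) t w - X w| ^+ 2)%:E)%E.
pose N1 n := integrand_norm2 P Qh t (fun s w v => elementary_process (cs n) s w v - Phi s w v).
pose N2 n := integrand_norm2 P Qh t (fun s w v => elementary_process (cs' n) s w v - Psi s w v).
pose J n w := inner (elementary_integral L (ds n) t w) f.
have mJ n : measurable_fun setT (J n).
  by have [] := sq_integrable_elementary sepV hF levyL sqL f t0 (wds n).
have mI2 n : measurable_fun setT (fun w => inner (elementary_integral L (cs' n) t w) f).
  by have [] := sq_integrable_elementary sepV hF levyL sqL f t0 (wcs' n).
have mI1 n : measurable_fun setT (fun w => inner (T (elementary_integral L (cs n) t w)) f).
  under eq_fun do rewrite -(elementary_integral_map L _ _ _ bT).
  by have [] := sq_integrable_elementary sepV hF levyL sqL f t0 (wf_map_terms bT (wcs n)).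
(* Both approximations are centred at [Psi], which equals T [Phi] on [[0, t]]; the factor 2 is that
   of (p - q)^2 <= 2 (p^2 + q^2). *)
have EJ n : (\int[P]_w (J n w ^+ 2)%:E <= 2%:E * (N1 n + N2 n))%E.
  rewrite (elementary_isometry sepV hF levyL sqL meanL hQ covL hQh eP f t0 (wds n)).
  pose G1 (p : R * Omega) := coord_energy Qh e
    (fun v => T (elementary_process (cs n) p.1 p.2 v) - Psi p.1 p.2 v) f.
  pose G2 (p : R * Omega) := coord_energy Qh e
    (fun v => elementary_process (cs' n) p.1 p.2 v - Psi p.1 p.2 v) f.
  apply: (@le_trans _ _ (\int[P]_w \int[lebesgue_measure]_(s in `[0%R, t])
      (2%:E * (G1 (s, w) + G2 (s, w))))%E).
    apply: le_lower_integral => w _; first by apply: integral_ge0 => s _; exact: coord_energy_ge0.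
    apply: le_lower_integral => s _; first exact: coord_energy_ge0.
    apply: (le_trans _ (coord_energyB Qh e
      (fun v => T (elementary_process (cs n) s w v) - Psi s w v)
      (fun v => elementary_process (cs' n) s w v - Psi s w v) f)).
    rewrite le_eqVlt; apply/orP; left; apply/eqP; congr coord_energy.
    by apply/funext => v; rewrite dsP opprB addrA subrK.
  have mPsi v : measurable_fun (`[0, t] `*` setT : set (R * Omega)) (fun p => inner (Psi p.1 p.2 v) f).
    exact: (measurable_predictable hF (f := fun s w => Psi s w v) f (pPsi v)).
  rewrite iterated_integralD//; last 4 first.
  - apply: (@measurable_coord_energy _ _ _ _ Qh e _
      (fun s w v => T (elementary_process (cs n) s w v) - Psi s w v)) => v.
    apply: measurable_innerB => //=.
    rewrite (_ : (fun _ => _) = fun p => inner (elementary_process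
        [seq map_term T c | c <- cs n] p.1 p.2 v) f); last first.
      by apply/funext => p; rewrite elementary_process_map.
    apply: measurable_funTS; apply: (measurable_elementary hF).
    exact: wf_map_terms.
  - apply: (@measurable_coord_energy _ _ _ _ Qh e _
      (fun s w v => elementary_process (cs' n) s w v - Psi s w v)) => v.
    apply: measurable_innerB => //=.
    by apply: measurable_funTS; apply: (measurable_elementary hF).
  - by move=> p; exact: coord_energy_ge0.
  - by move=> p; exact: coord_energy_ge0.
  rewrite lee_pmul2l//; apply: leeD.
    apply: le_lower_integral => w _; first by apply: integral_ge0 => s _; exact: coord_energy_ge0.
    apply: le_lower_integral => s; first by move=> _; exact: coord_energy_ge0.
    rewrite /= in_itv /= => /andP[s0 st].
    apply: (coord_energy_le_hs hQh hs_e
      (B := fun v => elementary_process (cs n) s w v - Phi s w v)).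
      by rewrite (bounded_linear_elementary _ _ (wcs n)) (bounded_linear0 (bPhi s w s0 st)) subrr.
    by move=> v; rewrite -TPhi// -bounded_linearB.
  apply: le_lower_integral => w _; first by apply: integral_ge0 => s _; exact: coord_energy_ge0.
  apply: le_lower_integral => s; first by move=> _; exact: coord_energy_ge0.
  rewrite /= in_itv /= => /andP[s0 st].
  apply: (coord_energy_le_hs hQh hs_e
    (B := fun v => elementary_process (cs' n) s w v - Psi s w v)) => //.
  by rewrite (bounded_linear_elementary _ _ (wcs' n)) (bounded_linear0 (bPsi s w s0 st)) subrr.
have bound n : (\int[P]_w (D w ^+ 2)%:E <=
    3%:E * (e2 n + (2%:E * (N1 n + N2 n) + e1 n)))%E.
  pose a w := inner (X w - elementary_integral L (cs' n) t w) f.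
  pose c w := inner (T (elementary_integral L (cs n) t w) - T (Z w)) f.
  have ma : measurable_fun setT a.
    exact: measurable_innerB.
  have mc : measurable_fun setT c.
    exact: measurable_innerB.
  have m2 (g : Omega -> R) : measurable_fun setT g -> measurable_fun setT (fun w => (g w ^+ 2)%:E).
    by move=> mg; apply/measurable_EFinP; exact: measurable_funX.
  have s0 (g : Omega -> R) w : setT w -> (0 <= (g w ^+ 2)%:E)%E.
    by move=> _; rewrite lee_fin sqr_ge0.
  (* Since D = a - J + c, the factor 3 comes from 3 (p^2 + q^2 + r^2) - (p - q + r)^2 = (p + q)^2 +
     (p - r)^2 + (q + r)^2. *)
  apply: (@le_trans _ _ (\int[P]_w (3%:E * ((a w ^+ 2)%:E + ((J n w ^+ 2)%:E + (c w ^+ 2)%:E))))%E).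
    apply: le_lower_integral => w _; rewrite -?EFinD -?EFinM lee_fin ?sqr_ge0//.
    have -> : D w = a w - J n w + c w.
      by rewrite /D /a /J /c dsI !innerBl; ring.
    set p := a w; set q := J n w; set r := c w.
    have := sqr_ge0 (p + q); have := sqr_ge0 (p - r); have := sqr_ge0 (q + r); nra.
  rewrite ge0_integralZl//; last 2 first.
  - by apply: emeasurable_funD; [exact: m2|apply: emeasurable_funD; exact: m2].
  - by move=> w _; rewrite -!EFinD lee_fin !addr_ge0 ?sqr_ge0.
  rewrite lee_pmul2l// ge0_integralD//; [|exact: s0|exact: m2| |]; last 2 first.
  - by move=> w _; rewrite -EFinD lee_fin !addr_ge0 ?sqr_ge0.
  - by apply: emeasurable_funD; exact: m2.
  rewrite ge0_integralD//; [|exact: s0|exact: m2|exact: s0|exact: m2].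
  apply: leeD; last apply: leeD => //.
    by apply: le_lower_integral => w _; rewrite lee_fin ?sqr_ge0// distrC f_le.
  by apply: le_lower_integral => w _; rewrite lee_fin ?sqr_ge0// /c -bounded_linearB.
have lim0 : (3%:E * (e2 n + (2%:E * (N1 n + N2 n) + e1 n)) @[n --> \oo] --> 0)%E.
  have comb (p q r z : nat -> \bar R) : p n @[n --> \oo] --> 0%E ->
      q n @[n --> \oo] --> 0%E -> r n @[n --> \oo] --> 0%E -> z n @[n --> \oo] --> 0%E ->
      (3%:E * (p n + (2%:E * (q n + r n) + z n)))%E @[n --> \oo] --> 0%E.
    move=> p0 q0 r0 z0.
    have qr0 : (2%:E * (q n + r n))%E @[n --> \oo] --> 0%E.
      by rewrite -(mule0 2%:E); apply: cvgeZl => //; rewrite -[0%E]adde0; exact: cvgeD.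
    rewrite -(mule0 3%:E); apply: cvgeZl => //; rewrite -[0%E]adde0.
    by apply: cvgeD => //; rewrite -[0%E]adde0; exact: cvgeD.
  exact: comb Ics' Ncs Ncs' Ics.
have D0 : (\int[P]_w (D w ^+ 2)%:E = 0)%E.
  apply/eqP; rewrite eq_le; apply/andP; split; last first.
    by apply: integral_ge0 => w _; rewrite lee_fin sqr_ge0.
  rewrite -(cvg_lim _ lim0)//; apply: lime_ge; first by apply/cvg_ex; exists 0%E.
  by apply: nearW => n; exact: bound.
have : ae_eq P setT (fun w => (D w ^+ 2)%:E) (cst 0%E).
  apply/ae_eq_integral_abs => //; first by apply/measurable_EFinP; exact: measurable_funX.
  by rewrite -[RHS]D0; apply: eq_integral => w _; rewrite /= ger0_norm ?sqr_ge0.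
apply: filterS => w /(_ I) /= h; have {h}/eqP := EFin_inj h.
by rewrite sqrf_eq0 => /eqP.
Qed.

Lemma stochastic_integral_map_unique : separable H -> {ae P, forall w, X w = T (Z w)}.
Proof.
move=> [C cC dC]; have [M M0 TM] := bounded_linear_bound bT.
have coord0 (f : H) : {ae P, forall w, inner (X w - T (Z w)) f = 0}.
  (* Scaled by r, the vector f satisfies both |r f| <= 1 and M |r f| <= 1; as r > 0, the conclusion
     scales back to f. *)
  pose r := ((1 + M) * (1 + `|f|))^-1.
  have fp : 0 < 1 + `|f| by rewrite ltr_pwDl.
  have Mp : 0 < 1 + M by rewrite addr_gt0.
  have r0 : 0 < r by rewrite invr_gt0 mulr_gt0.
  have rfE : `|r *: f| = r * `|f| by rewrite normrZ gtr0_norm.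
  have rf1 : `|r *: f| <= 1.
    rewrite rfE /r mulrC ler_pdivrMr ?mulr_gt0// mul1r.
    have := normr_ge0 f; nra.
  have Mrf1 : M * `|r *: f| <= 1.
    rewrite rfE mulrCA /r mulrC ler_pdivrMr ?mulr_gt0// mul1r.
    have := normr_ge0 f; nra.
  have := @stochastic_integral_coord (r *: f) rf1.
  case=> [v|N [mN N0 subN]].
    rewrite (le_trans (cauchy_schwarz_sqr _ _))// !inner_norm -exprMn.
    rewrite ler_pXn2r ?nnegrE ?mulr_ge0//.
    apply: (@le_trans _ _ (M * `|v| * `|r *: f|)); first by rewrite ler_wpM2r.
    by rewrite mulrAC ler_piMl.
  exists N; split=> // w /= h; apply: subN => /= h'; apply: h.
  by move/eqP: h'; rewrite innerZr mulf_eq0 (gt_eqF r0) /= => /eqP.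
have /countable_injP [g ginj] := cC.
(* The dense set is indexed by its codes under g, so that countably many null sets combine over
   [nat]; a number that is no code imposes nothing. *)
have : {ae P, forall w, forall n, forall f, C f -> g f = n -> inner (X w - T (Z w)) f = 0}.
  apply: ae_foralln => n.
  have [[f [Cf gf]]|nf] := pselect (exists f, C f /\ g f = n).
    apply: filterS (coord0 f) => w h f' Cf' gf'.
    by rewrite (ginj f' f) ?inE ?gf'.
  by apply: nearW => w f Cf gf; case: nf; exists f.
apply: filterS => w h; apply/eqP; rewrite -subr_eq0; apply/eqP.
by apply: (dense_inner_eq0 dC) => f Cf; exact: h Cf erefl.
Qed.

End Uniqueness.

(** Every clause of [stochastic_integral] sees the integrand only on [[0, t]]. The shift identity
    for the Gamma curves is available only there. *)
Lemma stochastic_integral_ext (R : realType) (d : measure_display)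
    (Omega : measurableType d) (P : probability Omega R) (F : R -> set (set Omega))
    (V E : hilbertType R) (L : R -> Omega -> V) (Qh : V -> V)
    (Phi Psi : R -> Omega -> V -> E) (t : R) (Z : Omega -> E) :
  (forall s w v, 0 <= s -> s <= t -> Phi s w v = Psi s w v) ->
  stochastic_integral P F L Qh Phi t Z -> stochastic_integral P F L Qh Psi t Z.
Proof.
move=> PhiPsi; have PhiPsi' s w : 0 <= s -> s <= t -> Phi s w = Psi s w.
  by move=> s0 st; apply/funext => v; exact: PhiPsi.
have normE (A B : R -> Omega -> V -> E) :
    (forall s w, 0 <= s -> s <= t -> A s w = B s w) ->
    integrand_norm2 P Qh t A = integrand_norm2 P Qh t B.
  move=> AB; apply: eq_integral => w _; apply: eq_integral => s.
  by rewrite inE /= in_itv /= => /andP[s0 st]; rewrite AB.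
case=> bPhi pPhi nPhi mZ [cs [wcs Ncs Ics]]; split.
- by move=> s w s0 st; rewrite -PhiPsi'//; exact: bPhi.
- move=> v O oO; have := pPhi v O oO; congr (predictable_set F).
  apply/seteqP; split=> -[s w] /= [s0]; case: ifP => st; rewrite ?PhiPsi//.
- by rewrite -(normE Phi).
- exact: mZ.
- exists cs; split; [exact: wcs| |exact: Ics].
  rewrite (_ : (fun n => _) = fun n => integrand_norm2 P Qh t
      (fun s w v => elementary_process (cs n) s w v - Phi s w v)); first exact: Ncs.
  apply/funext => n; apply: normE => s w s0 st; apply/funext => v.
  by rewrite PhiPsi.
Qed.

Unset Implicit Arguments.
Theorem corollary3p2 (R : realType) (d : measure_display)
    (Omega : measurableType d) (P : probability Omega R)
    (F : R -> set (set Omega))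
    (U V H Ht : hilbertType R)
    (sigma : R -> Omega -> U) (Gamma : R -> R -> U -> V -> H)
    (L : R -> Omega -> V) (Q Qh : V -> V)
    (ev : Ht -> R -> H)
    (X : R -> Omega -> H) (Y : R -> Omega -> Ht)
    (* the standing setting *)
    (hF : filtration F)
    (sepU : separable U) (sepV : separable V)
    (sepH : separable H) (sepHt : separable Ht)
    (hsigma : predictable F sigma)
    (hGamma : forall t s : R, 0 <= t -> 0 <= s -> bounded_linear2 (Gamma t s))
    (mGamma : forall O : set (U -> V -> H), opnorm_open O ->
       measurable [set p : R * R | [/\ 0 <= p.1, 0 <= p.2 & O (Gamma p.1 p.2)]])
    (levyL : levy_process P F L)
    (sqL : square_integrable_process P L)
    (meanL : zero_mean P L)
    (hQ : covariance_op Q) (covL : has_covariance P L Q)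
    (hQh : is_sqrt_op Q Qh)
    (intX : forall t : R, 0 <= t ->
       (integrand_norm2 P Qh t (fun s w v => Gamma t s (sigma s w) v) < +oo)%E)
    (* the space of functions and its shift semigroup *)
    (hev : function_space ev)
    (shift_in : forall (xi : R) (f : Ht), 0 <= xi -> in_space ev (fun x => ev f (xi + x)))
    (shiftC0 : C0_semigroup (shift_op ev))
    (Gamma_in : forall (t : R) (w : Omega) (v : V), 0 <= t ->
       in_space ev (fun xi => Gamma (t + xi) t (sigma t w) v))
    (Gamma_op : forall (t : R) (w : Omega), 0 <= t ->
       bounded_linear (Gamma_curve ev Gamma sigma t t w))
    (intB : forall t : R, 0 <= t ->
       (integrand_norm2 P Qh t
          (fun s => Gamma_curve ev Gamma sigma s s) < +oo)%E)
    (intY : forall t : R, 0 <= t ->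
       (integrand_norm2 P Qh t
          (Gamma_curve ev Gamma sigma t) < +oo)%E)
    (* X is the Hambit field *)
    (hX : forall t : R, 0 <= t ->
       stochastic_integral P F L Qh (fun s w v => Gamma t s (sigma s w) v) t (X t))
    (* the evaluation maps are bounded *)
    (hdelta : forall x : R, 0 <= x -> bounded_linear (fun f => ev f x))
    (* Y(t) = S_t Y(0) + int_0^t Gamma(t + ., s)(sigma(s)) dL(s) *)
    (hY : forall t : R, 0 <= t -> exists2 Z : Omega -> Ht,
       stochastic_integral P F L Qh
         (Gamma_curve ev Gamma sigma t) t Z &
       {ae P, forall w, Y t w = shift_op ev t (Y 0 w) + Z w}) :
  mild_solution P F L Qh (generator (shift_op ev))
    (fun t => Gamma_curve ev Gamma sigma t t) Y /\
  ({ae P, forall w, Y 0 w = 0} ->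
   forall t : R, 0 <= t -> {ae P, forall w, X t w = ev (Y t w) 0}).

Proof.
have bev0 := hdelta 0 (lexx 0).
have elt_in g : in_space ev g -> forall x, 0 <= x -> ev (elt ev g) x = g x.
  by move=> [f gf]; rewrite /elt; case: xgetP => [f' _ //|/(_ f)/(_ gf)].
have curveE t s w v : 0 <= s -> s <= t ->
    shift_op ev (t - s) (Gamma_curve ev Gamma sigma s s w v) =
    Gamma_curve ev Gamma sigma t s w v.
  (* Both sides are the same choice [xget 0] from a set of representatives, so it suffices that the
     two functions agree on R_+. *)
  move=> s0 st; rewrite /shift_op {2}/Gamma_curve /elt; congr (xget 0 _).
  have E x : 0 <= x -> ev (Gamma_curve ev Gamma sigma s s w v) (t - s + x) =
      Gamma (t + x) s (sigma s w) v.
    move=> x0; rewrite /Gamma_curve elt_in; first by rewrite addrA subrKC.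
      exact: Gamma_in.
    by rewrite addr_ge0// subr_ge0.
  by apply/seteqP; split=> f fE x x0; rewrite fE// E.
have curve0 t s w v : 0 <= s -> s <= t ->
    ev (Gamma_curve ev Gamma sigma t s w v) 0 = Gamma t s (sigma s w) v.
  (* [Gamma_in] covers only the curves starting on the diagonal; Gamma(t + ., s) with s < t is
     reached as a shift of the curve at s, via [shift_in]. *)
  move=> s0 st; rewrite -curveE// /shift_op elt_in//; last first.
    by apply: shift_in; rewrite subr_ge0.
  rewrite addr0 /Gamma_curve elt_in ?subr_ge0//; last exact: Gamma_in.
  by rewrite subrKC.
split.
  exists (shift_op ev); split; [exact: shiftC0|exact: erefl|move=> t t0].
  have [Z siZ YZ] := hY t t0; exists Z; last exact: YZ.
  by apply: stochastic_integral_ext siZ => s w v s0 st; rewrite curveE.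
move=> Y0 t t0; have [Z siZ YZ] := hY t t0.
(* The intertwining operator is evaluation at 0, and [curve0] is the intertwining relation. *)
have := stochastic_integral_map_unique sepV hF levyL sqL meanL hQ covL hQh t0 bev0
  (fun s w v => @curve0 t s w v) siZ (hX t t0) sepH.
have [S0 _ _ _] := shiftC0.
apply: filterS3 YZ Y0 => w -> -> ->.
by rewrite (bounded_linear0 (S0 t t0)) add0r.
Qed.
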